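(* Let $\mathbb{M}$ be a monster model of the theory $\widehat T$ (the theory of the generic meet tree with a circular order on the open cones above each point, with one constant named). Then no finite subset of $\mathbb{M}$ is a $\downarrow^f$-extension base.
   Context: A meet tree is a structure $(T,\leq,\wedge)$ where $\leq$ is a partial order such that for every $x$ the set $\{y:y\leq x\}$ is linearly ordered, and for all $x,y$ the set $\{z:z\leq x,y\}$ has a greatest element $x\wedge y$. For $a,b>c$ write $a\sim_c b$ if $a\wedge b>c$; this is an equivalence relation on $\{a:a>c\}$ whose classes are the open cones above $c$. Let $L^*=\{\leq,\wedge,C^*(x,y_1,y_2,y_3)\}$ and let $T^*_\forall$ be the $L^*$-theory consisting of the axioms of meet trees together with: (i) if $C^*(x,y_0,y_1,y_2)$ and $y_i\sim_x y_i'$ for $i<3$, then $C^*(x,y_0',y_1',y_2')$; (ii) $C^*(x,y_0,y_1,y_2)$ implies $x<y_i$ for $i<3$; (iii) for every $x$, $C^*(x,-,-,-)$ induces a (strict) circular order on the set of open cones above $x$. The finite models of $T^*_\forall$ form a uniformly locally finite Fraïssé class; let $T^*$ be the theory of its Fraïssé limit (it is $\omega$-categorical, NIP, has quantifier elimination, and is the model completion of $T^*_\forall$). Choose a model $M\models T^*$ and any element $r\in M$, and let $\widehat T:=\operatorname{Th}(M,r)$ in the language $\widehat L=\{\leq,\wedge,C^*,r\}$ with $r$ a constant symbol. In a sufficiently saturated and homogeneous monster model $\mathbb{M}$: a formula $\varphi(x,b)$ divides over a small set $A$ if there is an $A$-indiscernible sequence $(b_i)_{i\in\omega}$ with $b_i\equiv_A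 b$ such that $\{\varphi(x,b_i):i\in\omega\}$ is inconsistent; it forks over $A$ if it implies a finite disjunction of formulas with parameters in $\mathbb{M}$, each dividing over $A$; a partial type forks over $A$ if it implies a formula forking over $A$. Write $a\downarrow^f_A b$ if $\operatorname{tp}(a/Ab)$ does not fork over $A$. A small set $A$ is a $\downarrow^f$-extension base if $a\downarrow^f_A A$ for all tuples $a$. *)

(* Defs.v *)
From mathcomp Require Import all_boot.
From mathcomp Require Import boolp classical_sets functions cardinality.

Set Implicit Arguments.
Unset Strict Implicit.
Unset Printing Implicit Defensive.

Local Open Scope classical_set_scope.
Local Open Scope card_scope.

(** * First-order logic *)

Record language := Language {
  func : Type;
  farity : func -> nat;
  rsym : Type;
  rarity : rsym -> nat }.

Record structure (L : language) := Structure {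
  carrier :> Type;
  ifunc : forall f : func L, ('I_(farity f) -> carrier) -> carrier;
  irel : forall R : rsym L, ('I_(rarity R) -> carrier) -> Prop }.

(* Terms and formulas are well scoped: their free variables range over the type
   [V], and [All] binds the variable [None] of a formula over [option V].
   Classically, falsity, implication and the universal quantifier suffice. *)
Inductive term (L : language) (V : Type) : Type :=
| Var (x : V)
| App (f : func L) (args : 'I_(farity f) -> term L V).

Inductive formula (L : language) (V : Type) : Type :=
| Eq (s t : term L V)
| Rel (R : rsym L) (args : 'I_(rarity R) -> term L V)
| Bot
| Imp (phi psi : formula L V)
| All (phi : formula L (option V)).

Fixpoint eval L (M : structure L) (V : Type) (v : V -> M) (t : term L V) : M :=
  match t with
  | Var x => v x
  | App f args => ifunc (fun i => eval v (args i))
  end.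

Fixpoint sat L (M : structure L) (V : Type) (phi : formula L V) (v : V -> M) : Prop :=
  match phi with
  | Eq s t => eval v s = eval v t
  | Rel R args => irel (fun i => eval v (args i))
  | Bot => False
  | Imp phi psi => sat phi v -> sat psi v
  | All phi => forall x : M, sat phi (oapp v x)
  end.

Definition sentence L := formula L void.

Definition Th L (M : structure L) : set (sentence L) :=
  [set phi | sat phi (of_void M)].

Definition model_of L (M : structure L) (T : set (sentence L)) : Prop :=
  forall phi, T phi -> sat phi (of_void M).

Definition add_const (L : language) : language :=
  @Language (option (func L)) (oapp (@farity L) 0) (rsym L) (@rarity L).

Definition name_const L (M : structure L) (r : M) : structure (add_const L) :=
  @Structure (add_const L) M
    (fun f : option (func L) =>
       match f return ('I_(oapp (@farity L) 0 f) -> M) -> M with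
       | Some f => fun args => ifunc args
       | None => fun _ => r
       end)
    (@irel L M).

(** * Embeddings and Fraisse limits *)

(* The restriction of [f] to [A] is an embedding; meant for [A] closed under
   the function symbols. *)
Definition embedding_on L (M N : structure L) (A : set M) (f : M -> N) : Prop :=
  [/\ {in A &, injective f},
      forall (g : func L) (args : 'I_(farity g) -> M), (forall i, A (args i)) ->
        f (ifunc args) = ifunc (f \o args)
    & forall (R : rsym L) (args : 'I_(rarity R) -> M), (forall i, A (args i)) ->
        irel args <-> irel (f \o args)].

Definition embedding L (M N : structure L) (f : M -> N) : Prop :=
  embedding_on setT f.

Definition automorphism L (M : structure L) (f : M -> M) : Prop :=
  embedding f /\ bijective f.

Definition closed_under_functions L (M : structure L) (A : set M) : Prop :=
  forall (g : func L) (args : 'I_(farity g) -> M),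
    (forall i, A (args i)) -> A (ifunc args).

Definition generated L (M : structure L) (S : set M) : set M :=
  smallest (@closed_under_functions L M) S.

Definition finitely_generated L (M : structure L) : Prop :=
  exists2 S : set M, finite_set S & generated S = setT.

Definition age L (M N : structure L) : Prop :=
  finitely_generated N /\ exists f : N -> M, embedding f.

(* Isomorphisms between finitely generated substructures are presented as maps
   that restrict to an embedding of the substructure generated by [S]; the
   target substructure is then the image. *)
Definition ultrahomogeneous L (M : structure L) : Prop :=
  forall (S : set M) (f : M -> M), finite_set S ->
    embedding_on (generated S) f ->
    exists2 g, automorphism g & {in generated S, g =1 f}.

Definition fraisse_limit L (K : structure L -> Prop) (M : structure L) : Prop :=
  [/\ countable [set: M],
      forall N : structure L, age M N <-> K N
    & ultrahomogeneous M].

(** * Types, saturation and monster models *)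

Definition vsum (X Y T : Type) (a : X -> T) (b : Y -> T) (z : X + Y) : T :=
  match z with inl x => a x | inr y => b y end.

(* The elements of [A], seen as a type, serve as parameters: an L(A)-formula in
   the variables [X] is an element of [formula L (X + A)]. *)
Definition ptype L (M : structure L) (X : Type) (A : set M) :=
  set (formula L (X + A)).

Definition realizes L (M : structure L) (X : Type) (A : set M) (p : ptype X A)
    (a : X -> M) : Prop :=
  forall phi, p phi -> sat phi (vsum a (fun c : A => val c)).

Definition tp L (M : structure L) (X : Type) (A : set M) (a : X -> M) : ptype X A :=
  [set phi | sat phi (vsum a (fun c : A => val c))].

Arguments tp {L M X} A a.

Definition finitely_satisfiable L (M : structure L) (X : Type) (A : set M)
    (p : ptype X A) : Prop :=
  forall p0 : ptype X A, finite_set p0 -> p0 `<=` p ->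
    exists a, realizes p0 a.

(* Cardinals are represented by types: [|A| < |kappa|]. *)
Definition small (kappa T : Type) (A : set T) : Prop :=
  A #<= [set: kappa] /\ ~~ ([set: kappa] #<= A).

Definition saturated (kappa : Type) L (M : structure L) : Prop :=
  forall (A : set M) (p : ptype unit A), small kappa A ->
    finitely_satisfiable p -> exists a, realizes p a.

Definition elementary_on L (M : structure L) (A : set M) (f : M -> M) : Prop :=
  forall phi : formula L A,
    sat phi (fun c : A => val c) <-> sat phi (fun c : A => f (val c)).

Definition strongly_homogeneous (kappa : Type) L (M : structure L) : Prop :=
  forall (A : set M) (f : M -> M), small kappa A -> elementary_on A f ->
    exists2 g, automorphism g & {in A, g =1 f}.

Definition monster (kappa : Type) L (M : structure L) : Prop :=
  [/\ ~ countable [set: kappa], saturated kappa M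
    & strongly_homogeneous kappa M].

(** * Dividing and forking *)

Definition indiscernible L (M : structure L) m (A : set M)
    (b : nat -> 'I_m -> M) : Prop :=
  forall k (s t : 'I_k -> nat),
    {homo s : i j / i < j} -> {homo t : i j / i < j} ->
    tp A (fun z : 'I_k * 'I_m => b (s z.1) z.2) =
    tp A (fun z : 'I_k * 'I_m => b (t z.1) z.2).

(* A formula phi(x, b) with x an n-tuple of variables and b a finite tuple of
   parameters. *)
Record pformula L (M : structure L) (n : nat) := PFormula {
  nparam : nat;
  pshape : formula L ('I_n + 'I_nparam);
  pparam : 'I_nparam -> M }.

Definition holds L (M : structure L) n (phi : pformula M n) (a : 'I_n -> M) :=
  sat (pshape phi) (vsum a (@pparam _ _ _ phi)).

Definition divides L (M : structure L) n (A : set M) (phi : pformula M n) :=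
  exists b : nat -> 'I_(nparam phi) -> M,
    [/\ indiscernible A b,
        forall i, tp A (b i) = tp A (@pparam _ _ _ phi)
      & ~ exists a, forall i, sat (pshape phi) (vsum a (b i))].

Definition forks L (M : structure L) n (A : set M) (phi : pformula M n) :=
  exists (k : nat) (psi : 'I_k -> pformula M n),
    (forall j, divides A (psi j)) /\
    (forall a, holds phi a -> exists j, holds (psi j) a).

(* Implications between types and formulas are evaluated in the ambient model,
   which is meant to be a monster model with [B] small. *)
Definition type_forks L (M : structure L) n (A B : set M) (p : ptype 'I_n B) :=
  exists2 phi : pformula M n, forks A phi &
    forall a, realizes p a -> holds phi a.

Definition fork_independent L (M : structure L) n (A : set M) (a : 'I_n -> M)
    (B : set M) : Prop :=
  ~ type_forks A (tp (A `|` B) a).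

Definition extension_base L (M : structure L) (A : set M) : Prop :=
  forall n (a : 'I_n -> M), fork_independent A a A.

(** * Meet trees with circular orders on open cones *)

Inductive Lstar_func := Meet.
Inductive Lstar_rel := Le | Cstar.

Definition Lstar : language :=
  @Language Lstar_func (fun=> 2) Lstar_rel (fun R => if R is Le then 2 else 4).

Section MeetTree.
Variable M : structure Lstar.
Implicit Types x y z : M.

Definition tle x y : Prop := @irel Lstar M Le (tnth [tuple x; y]).
Definition tmeet x y : M := @ifunc Lstar M Meet (tnth [tuple x; y]).
Definition tC x y1 y2 y3 : Prop :=
  @irel Lstar M Cstar (tnth [tuple x; y1; y2; y3]).

Definition tlt x y : Prop := tle x y /\ x <> y.

Definition meet_tree : Prop :=
  [/\ forall x, tle x x,
      forall x y, tle x y -> tle y x -> x = y,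
      forall x y z, tle x y -> tle y z -> tle x z,
      forall x y z, tle y x -> tle z x -> tle y z \/ tle z y
    & forall x y, [/\ tle (tmeet x y) x, tle (tmeet x y) y
        & forall z, tle z x -> tle z y -> tle z (tmeet x y)]].

Definition same_cone c a b : Prop := [/\ tlt c a, tlt c b & tlt c (tmeet a b)].

Definition open_cones c : set (set M) :=
  [set [set b | same_cone c a b] | a in [set a | tlt c a]].

Definition cone_rel x (U V W : set M) : Prop :=
  exists u v w, [/\ U u, V v, W w & tC x u v w].

End MeetTree.

Definition strict_circular_order (T : Type) (D : set T) (C : T -> T -> T -> Prop) : Prop :=
  [/\ forall a b c, D a -> D b -> D c -> C a b c -> C b c a,
      forall a b c, D a -> D b -> D c -> C a b c -> ~ C c b a,
      forall a b c d, D a -> D b -> D c -> D d ->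
        C a b c -> C a c d -> C a b d
    & forall a b c, D a -> D b -> D c -> a <> b -> b <> c -> a <> c ->
        C a b c \/ C c b a].

Definition Tstar_forall (M : structure Lstar) : Prop :=
  [/\ meet_tree M,
      forall x y0 y1 y2 y0' y1' y2' : M, tC x y0 y1 y2 ->
        same_cone x y0 y0' -> same_cone x y1 y1' -> same_cone x y2 y2' ->
        tC x y0' y1' y2',
      forall x y0 y1 y2 : M, tC x y0 y1 y2 -> [/\ tlt x y0, tlt x y1 & tlt x y2]
    & forall x : M, strict_circular_order (open_cones x) (cone_rel x)].

Definition finite_Tstar_forall (M : structure Lstar) : Prop :=
  finite_set [set: M] /\ Tstar_forall M.

(* L-hat = {<=, meet, C*, r}: the extra constant is the function symbol [None]. *)
Definition Lhat : language := add_const Lstar.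

(* Main.v *)
Require Import Defs.
From mathcomp Require Import all_boot.
From mathcomp Require Import boolp classical_sets functions cardinality.
From mathcomp Require Import zify.
Set Implicit Arguments.
Unset Strict Implicit.
Unset Printing Implicit Defensive.

(** Why the theorem is true.  Let [m] be a maximal element of the finite set
[A] together with the root.  No element of the substructure generated by
[A] lies above [m], so this substructure marks no open cone above [m], and
the cones above [m] form a dense circular order in which no point is
distinguished.  Such a circle is the standard example of forking over a set:
given [a] and [b] in different cones above [m], every [x] above [m] lies in
the closed arc from [a] to [b] or in the closed arc from [b] to [a], because
[C] is asymmetric, and each of the two arcs divides over [A].  Indeed one
can place infinitely many pairwise disjoint arcs around the circle.  Hence
the formula [m < x] forks over [A] ([forks_above]), and the type over [A] of
any point above [m] implies it, [m] being in [A] or the root.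

What has to be shown is that such a sequence of arcs is indiscernible over
[A] and that every arc has the type over [A] of the arc given at the start.
Both follow from quantifier elimination, in this form: two finite tuples,
closed under the functions and with the same atomic diagram, satisfy the same
formulas.  By back-and-forth ([back_and_forth]) this reduces to extending a
pair of such tuples by one element.  In the Fraisse limit [F] the extension is
ultrahomogeneity.  For a fixed finite diagram it is a first-order
statement, so it passes to every model of the theory of [F]
([limit_model_extend]), in particular to the reduct of the monster.
The elementwise axioms pass in the same way: they hold in [F] because each
finitely generated substructure of [F] is a model of the universal theory.

A tuple closed under meets together with points in distinct cones above a
maximal entry [m] is again closed, and its diagram depends only on that of the
tuple and on the circular order of the points ([crown_diagram]).  This gives
indiscernibility.  The points themselves exist because a root with finitely
many leaves in circular order is in the Fraisse class ([star_extend]). *)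

(** * Uniformly definable predicates *)

Definition absurd_index (T : Type) (i : 'I_0) : T := False_rect T (notF (ltn_ord i)).

Section Definability.
Variable L : language.

Fixpoint trename V W (f : V -> W) (t : term L V) : term L W :=
  match t with
  | Var x => Var L (f x)
  | App g args => App (fun i => trename f (args i))
  end.

Fixpoint frename V W (f : V -> W) (phi : formula L V) : formula L W :=
  match phi with
  | Eq s t => Eq (trename f s) (trename f t)
  | Rel R args => Rel (fun i => trename f (args i))
  | Bot => Bot L W
  | Imp phi psi => Imp (frename f phi) (frename f psi)
  | All phi => All (frename (omap f) phi)
  end.

Lemma eval_trename (N : structure L) V W (f : V -> W) (t : term L V) (w : W -> N) :
  eval w (trename f t) = eval (w \o f) t.
Proof. by elim: t => //= g args IH; congr ifunc; apply: funext. Qed.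

Lemma sat_frename (N : structure L) V (phi : formula L V) :
  forall W (f : V -> W) (w : W -> N),
  sat (frename f phi) w <-> sat phi (w \o f).
Proof.
elim: phi => {V} [V s t|V R args|V|V phi IHphi psi IHpsi|V phi IH] W f w /=.
- by rewrite !eval_trename.
- suff -> : (fun i => eval w (trename f (args i))) =
            (fun i => eval (w \o f) (args i)) by [].
  by apply: funext => i; rewrite eval_trename.
- by [].
- by rewrite IHphi IHpsi.
- have E x : oapp w x \o omap f = oapp (w \o f) x by apply: funext; case.
  by split=> H x; have := H x; rewrite IH E.
Qed.

(** First-order sentences are used here only to pass from one structure to
another, so formulas are not written out: a predicate on assignments, given
uniformly in all structures, is shown to be the interpretation of some
formula, and the connectives are handled semantically. *)
Definition definable V (P : forall N : structure L, (V -> N) -> Prop) :=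
  exists phi : formula L V, forall N v, sat phi v <-> P N v.

Definition term_definable V (t : forall N : structure L, (V -> N) -> N) :=
  exists s : term L V, forall N v, eval v s = t N v.

Lemma definable_iff V (P Q : forall N : structure L, (V -> N) -> Prop) :
  definable P -> (forall N v, P N v <-> Q N v) -> definable Q.
Proof. by move=> [phi Hphi] PQ; exists phi => N v; rewrite Hphi PQ. Qed.

Lemma definable_imp V (P Q : forall N : structure L, (V -> N) -> Prop) :
  definable P -> definable Q -> definable (fun N v => P N v -> Q N v).
Proof.
move=> [phi Hphi] [psi Hpsi]; exists (Imp phi psi) => N v /=.
by rewrite Hphi Hpsi.
Qed.

Lemma definable_cst V (Q : Prop) : @definable V (fun _ _ => Q).
Proof.
have [q|nq] := pselect Q; last by exists (Bot L V) => N v /=; tauto.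
by exists (Imp (Bot L V) (Bot L V)) => N v /=; tauto.
Qed.

Lemma definable_not V (P : forall N : structure L, (V -> N) -> Prop) :
  definable P -> definable (fun N v => ~ P N v).
Proof. by move=> defP; exact: definable_imp defP (definable_cst V False). Qed.

Lemma definable_and V (P Q : forall N : structure L, (V -> N) -> Prop) :
  definable P -> definable Q -> definable (fun N v => P N v /\ Q N v).
Proof.
move=> defP defQ.
apply: definable_iff (definable_not (definable_imp defP (definable_not defQ))) _.
by move=> N v; have := EM (P N v); have := EM (Q N v); tauto.
Qed.

Lemma definable_or V (P Q : forall N : structure L, (V -> N) -> Prop) :
  definable P -> definable Q -> definable (fun N v => P N v \/ Q N v).
Proof.
move=> defP defQ.
apply: definable_iff (definable_imp (definable_not defP) defQ) _ => N v.
by have := EM (P N v); tauto.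
Qed.

Lemma definable_equiv V (P Q : forall N : structure L, (V -> N) -> Prop) :
  definable P -> definable Q -> definable (fun N v => P N v <-> Q N v).
Proof. by move=> defP defQ; apply: definable_and; apply: definable_imp. Qed.

Lemma definable_rename V W (f : V -> W)
    (P : forall N : structure L, (V -> N) -> Prop) :
  definable P -> definable (fun N (w : W -> N) => P N (w \o f)).
Proof.
by move=> [phi Hphi]; exists (frename f phi) => N w; rewrite sat_frename.
Qed.

(** A conjunction over a type is finite as soon as a finite type maps onto it;
the surjection lets [T] be a type of functions such as ['I_n -> I]. *)
Lemma definable_forall_index (E : finType) (T : Type) (e : E -> T) V
    (P : T -> forall N : structure L, (V -> N) -> Prop) :
  (forall x, exists y, e y = x) -> (forall x, definable (P x)) ->
  definable (fun N v => forall x, P x N v).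
Proof.
move=> e_surj defP.
have aux (s : seq E) :
  definable (fun N v => forall y, y \in s -> P (e y) N v).
  elim: s => [|y s IH].
    by apply: definable_iff (definable_cst V True) _.
  apply: definable_iff (definable_and (defP (e y)) IH) _ => N v; split.
    by move=> [Py Ps] z; rewrite in_cons => /orP[/eqP-> //|/Ps].
  by move=> H; split=> [|z zs]; apply: H; rewrite in_cons ?eqxx ?zs ?orbT.
apply: definable_iff (aux (enum E)) _ => N v; split=> [H x|H y _ //].
by have [y <-] := e_surj x; apply: H; rewrite mem_enum.
Qed.

(** A quantifier over [n]-tuples is [n] single quantifiers: the induction turns
the first entry of the tuple into the variable bound by [All]. *)
Lemma definable_forall_ord n V
    (P : forall N : structure L, (V + 'I_n -> N) -> Prop) :
  definable P ->
  definable (fun N (v : V -> N) => forall w : 'I_n -> N, P N (vsum v w)).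
Proof.
elim: n V P => [|n IH] V P defP.
  pose f (z : V + 'I_0) := match z with inl x => x | inr i => absurd_index V i end.
  have E (N : structure L) (v : V -> N) w : vsum v w = v \o f.
    by apply: funext => -[//|[]].
  apply: definable_iff (definable_rename f defP) _ => N v.
  by split=> [H w|H]; [rewrite E | rewrite -(E _ _ (@absurd_index N))].
pose f (z : V + 'I_n.+1) : option V + 'I_n :=
  match z with
  | inl x => inl (Some x)
  | inr i => if unlift ord0 i is Some j then inr j else inl None
  end.
have [phi Hphi] := IH _ _ (definable_rename f defP).
exists (All phi) => N v /=; split=> [H w|H x].
  have /Hphi/(_ (w \o lift ord0)) := H (w ord0).
  congr (P N); apply: funext => -[//|i] /=.
  by case: unliftP => [j ->|->].
apply/Hphi => w.
have := H (fun i => if unlift ord0 i is Some j then w j else x).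
congr (P N); apply: funext => -[//|i] /=.
by case: (unlift ord0 i).
Qed.

Lemma definable_forall_tuple (I : finType) V
    (P : forall N : structure L, (V + I -> N) -> Prop) :
  definable P ->
  definable (fun N (v : V -> N) => forall w : I -> N, P N (vsum v w)).
Proof.
move=> defP.
pose f (z : V + I) : V + 'I_#|I| :=
  match z with inl x => inl x | inr i => inr (enum_rank i) end.
apply: definable_iff (definable_forall_ord (definable_rename f defP)) _ => N v.
have E w : vsum v (w \o enum_val) \o f = vsum v w.
  by apply: funext => -[//|i] /=; rewrite enum_rankK.
split=> [H w|H w]; first by rewrite -E.
have -> : vsum v w \o f = vsum v (w \o enum_rank) by apply: funext => -[].
exact: H.
Qed.

Lemma definable_exists_tuple (I : finType) V
    (P : forall N : structure L, (V + I -> N) -> Prop) :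
  definable P ->
  definable (fun N (v : V -> N) => exists w : I -> N, P N (vsum v w)).
Proof.
move=> defP.
apply: definable_iff
  (definable_not (definable_forall_tuple (definable_not defP))) _ => N v.
by rewrite -existsNE; split=> -[w Pw]; exists w => //; apply: contrapT.
Qed.

Definition elementary_property (P : structure L -> Prop) :=
  @definable void (fun N _ => P N).

Lemma elementary_forall (I : finType)
    (P : forall N : structure L, (I -> N) -> Prop) :
  definable P -> elementary_property (fun N => forall w : I -> N, P N w).
Proof.
move=> /(definable_rename (@inr void I)) /definable_forall_tuple defP.
by apply: definable_iff defP _.
Qed.

Lemma elementary_exists (I : finType)
    (P : forall N : structure L, (I -> N) -> Prop) :
  definable P -> elementary_property (fun N => exists w : I -> N, P N w).
Proof.
move=> /(definable_rename (@inr void I)) /definable_exists_tuple defP.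
by apply: definable_iff defP _.
Qed.

(** One inclusion between theories is enough, since the theory of [F] contains
the negation of each sentence that fails in [F]. *)
Lemma elementary_transfer (F N : structure L) (P : structure L -> Prop) :
  model_of N (Th F) -> elementary_property P -> P F <-> P N.
Proof.
move=> NF [phi Hphi]; split=> [PF|PN].
  by apply/(Hphi N (of_void N))/NF; apply/Hphi.
apply: contrapT => nPF.
by have := NF (Imp phi (Bot L void)); apply; first move=> /Hphi; last apply/Hphi.
Qed.

Lemma term_definable_var V (x : V) : term_definable (fun N v => v x).
Proof. by exists (Var L x). Qed.

Lemma definable_eq V (s t : forall N : structure L, (V -> N) -> N) :
  term_definable s -> term_definable t ->
  definable (fun N v => s N v = t N v).
Proof. by move=> [s' Hs] [t' Ht]; exists (Eq s' t') => N v /=; rewrite Hs Ht. Qed.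

Lemma term_definable_app (f : func L) V
    (t : 'I_(farity f) -> forall N : structure L, (V -> N) -> N) :
  (forall i, term_definable (t i)) ->
  term_definable (fun N v => ifunc (fun i => t i N v)).
Proof.
move=> /choice[s Hs]; exists (App s) => N v /=.
by congr ifunc; apply: funext => i.
Qed.

Lemma definable_rel (R : rsym L) V
    (t : 'I_(rarity R) -> forall N : structure L, (V -> N) -> N) :
  (forall i, term_definable (t i)) ->
  definable (fun N v => irel (fun i => t i N v)).
Proof.
move=> /choice[s Hs]; exists (Rel s) => N v /=.
suff -> : (fun i => eval v (s i)) = (fun i => t i N v) by [].
by apply: funext => i.
Qed.

(** [P] holds of the terms [s] if and only if it holds of every tuple equal to
[s]; this spares a syntactic substitution under binders. *)
Lemma definable_subst (V : finType) W
    (s : V -> forall N : structure L, (W -> N) -> N)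
    (P : forall N : structure L, (V -> N) -> Prop) :
  (forall x, term_definable (s x)) -> definable P ->
  definable (fun N w => P N (fun x => s x N w)).
Proof.
move=> /choice[s' Hs] defP.
have def : definable (fun N (w : W + V -> N) =>
    (forall x : V, w (inr x) = s x N (w \o inl)) -> P N (w \o inr)).
  apply: definable_imp; last exact: definable_rename.
  apply: (@definable_forall_index V V id) => [x|x]; first by exists x.
  apply: definable_eq; first exact: term_definable_var.
  by exists (trename inl (s' x)) => N v; rewrite eval_trename Hs.
apply: definable_iff (definable_forall_tuple def) _ => N w.
split=> [H|Pw u Eu]; first exact: (H (fun x => s x N w)).
suff -> : vsum w u \o inr = (fun x => s x N w) by [].
by apply: funext => x; exact: Eu.
Qed.

End Definability.

(** * Atomic diagrams and back-and-forth *)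

Section Diagram.
Variable L : language.

(** Repeated entries are allowed, and the functions occur as graphs among the
entries.  The relation therefore says that [a i |-> b i] is a well defined
partial isomorphism when [a] is closed under the functions, and it is
symmetric as it stands. *)
Definition same_diagram (I : Type) (M N : structure L) (a : I -> M) (b : I -> N) :=
  [/\ forall i j, a i = a j <-> b i = b j,
      forall (f : func L) (u : 'I_(farity f) -> I) k,
        ifunc (a \o u) = a k <-> ifunc (b \o u) = b k
    & forall (R : rsym L) (u : 'I_(rarity R) -> I),
        irel (a \o u) <-> irel (b \o u)].

Definition closed_tuple (I : Type) (M : structure L) (a : I -> M) :=
  forall (f : func L) (u : 'I_(farity f) -> I), exists k, ifunc (a \o u) = a k.

Lemma same_diagram_sym I (M N : structure L) (a : I -> M) (b : I -> N) :
  same_diagram a b -> same_diagram b a.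
Proof. by case=> E Fn Rl; split=> *; symmetry. Qed.

Lemma same_diagram_trans I (M N P : structure L)
    (a : I -> M) (b : I -> N) (c : I -> P) :
  same_diagram a b -> same_diagram b c -> same_diagram a c.
Proof.
case=> E Fn Rl [E' Fn' Rl']; split=> *; first by rewrite E E'.
  by rewrite Fn Fn'.
by rewrite Rl Rl'.
Qed.

Lemma same_diagram_comp I J (g : J -> I) (M N : structure L)
    (a : I -> M) (b : I -> N) :
  same_diagram a b -> same_diagram (a \o g) (b \o g).
Proof.
case=> E Fn Rl; split=> [i j|f u k|R u]; [exact: E | exact: (Fn f (g \o u)) |].
exact: (Rl R (g \o u)).
Qed.

Lemma same_diagram_embedding I (M N : structure L) (h : M -> N) (a : I -> M) :
  embedding h -> same_diagram a (h \o a).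
Proof.
case=> inj hfun hrel; split=> [i j|f u k|R u].
- by split=> [/= -> //|]; apply: inj; exact: in_setT.
- rewrite -[ifunc ((h \o a) \o u)]/(ifunc (h \o (a \o u))) -hfun //=.
  by split=> [-> //|]; apply: inj; exact: in_setT.
- exact: hrel.
Qed.

Lemma closed_same_diagram I (M N : structure L) (a : I -> M) (b : I -> N) :
  same_diagram a b -> closed_tuple a -> closed_tuple b.
Proof.
by case=> _ Fn _ clo f u; have [k /Fn] := clo f u; exists k.
Qed.

(** Only the [forth] half is demanded: [same_diagram] is symmetric, so the
condition for [b] and [a] is the [back] half. *)
Definition diagram_extension (M : structure L) :=
  forall (I : finType) (a b : I -> M) (x : M),
    closed_tuple a -> same_diagram a b ->
    exists (J : finType) (g : I -> J) (a' b' : J -> M),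
      [/\ closed_tuple a', same_diagram a' b', a' \o g = a, b' \o g = b
        & exists j, a' j = x].

(** The variables of the formula are read off the tuples through [rho], so that
the index type of the tuples can grow when a quantifier is opened while the
formula keeps its own variables. *)
Lemma back_and_forth (M : structure L) : diagram_extension M ->
  forall V (phi : formula L V) (I : finType) (a b : I -> M) (rho : V -> I),
  closed_tuple a -> same_diagram a b ->
  sat phi (a \o rho) <-> sat phi (b \o rho).
Proof.
move=> ext.
have evalP V (t : term L V) (I : finType) (a b : I -> M) (rho : V -> I) :
    closed_tuple a -> same_diagram a b ->
    exists i, eval (a \o rho) t = a i /\ eval (b \o rho) t = b i.
  move=> clo [_ Fn _]; elim: t => [x|f args /choice[u Hu]] /=.
    by exists (rho x).
  have [k Ek] := clo f u; exists k.
  rewrite -(proj1 (Fn f u k) Ek) -Ek.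
  by split; congr ifunc; apply: funext => i /=; case: (Hu i).
move=> V; elim=> {V} [V s t|V R args|V|V phi IHphi psi IHpsi|V phi IH] I a b rho
  clo ab /=.
- have [i [-> ->]] := evalP _ s _ _ _ rho clo ab.
  by have [j [-> ->]] := evalP _ t _ _ _ rho clo ab; case: ab => + _ _; apply.
- have /choice[u Hu] := fun i => evalP _ (args i) _ _ _ rho clo ab.
  have -> : (fun i => eval (a \o rho) (args i)) = a \o u.
    by apply: funext => i; case: (Hu i).
  have -> : (fun i => eval (b \o rho) (args i)) = b \o u.
    by apply: funext => i; case: (Hu i).
  by case: ab => _ _; apply.
- by [].
- by rewrite (IHphi _ _ _ rho clo ab) (IHpsi _ _ _ rho clo ab).
- have half (c d : I -> M) : closed_tuple c -> same_diagram c d ->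
      (forall x, sat phi (oapp (c \o rho) x)) ->
      forall x, sat phi (oapp (d \o rho) x).
    move=> cloc cd H x.
    have [J [g [d' [c' [clod dc' Ed Ec [j <-]]]]]] :=
      ext _ _ _ x (closed_same_diagram cd cloc) (same_diagram_sym cd).
    have E (e : J -> M) :
        oapp ((e \o g) \o rho) (e j) = e \o oapp (g \o rho) j.
      by apply: funext => -[].
    rewrite -Ed E; apply/(IH _ _ _ _ clod dc'); rewrite -E Ec; exact: H.
  split; first exact: half.
  by apply: half; [exact: closed_same_diagram ab clo | exact: same_diagram_sym].
Qed.

End Diagram.

(** * Extending diagrams in models of the theory of a Fraisse limit *)

Section Homogeneity.
Local Open Scope classical_set_scope.
Variable L : language.

Lemma generated_range (I : Type) (M : structure L) (a : I -> M) :
  closed_tuple a -> generated (range a) = range a.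
Proof.
move=> clo; apply/seteqP; split; last exact: sub_smallest.
apply: smallest_sub => // f args args_a.
have /choice[u Eu] : forall i, exists k, args i = a k.
  by move=> i; have [k _ <-] := args_a i; exists k.
have [k Ek] := clo f u; exists k => //; rewrite -Ek.
by congr ifunc; apply: funext.
Qed.

(** The map [x (g i) |-> a i] is an embedding of a finite substructure; an
automorphism extending it carries the rest of [x] to the required points. *)
Lemma ultrahomogeneous_extend (F : structure L) : ultrahomogeneous F ->
  forall (I : finType) (J : Type) (g : I -> J) (x : J -> F) (a : I -> F),
  closed_tuple (x \o g) -> same_diagram (x \o g) a ->
  exists2 a' : J -> F, same_diagram x a' & a' \o g = a.
Proof.
move=> homF I J g x a clo xa.
have /choice[f Hf] : forall y, exists z, forall i, (x \o g) i = y -> z = a i.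
  move=> y; have [[i <-]|no] := pselect (exists i, (x \o g) i = y).
    by exists (a i) => j; case: xa => E _ _ /E.
  by exists y => i Ei; case: no; exists i.
have fx : f \o (x \o g) = a by apply: funext => i; apply: Hf.
have emb : embedding_on (generated (range (x \o g))) f.
  rewrite generated_range //; case: xa => Exa Fn Rl.
  have rangeP n (args : 'I_n -> F) : (forall i, range (x \o g) (args i)) ->
      exists u, args = (x \o g) \o u.
    move=> args_x.
    have /choice[u Eu] : forall i, exists k, args i = (x \o g) k.
      by move=> i; have [k _ <-] := args_x i; exists k.
    by exists u; apply: funext.
  split=> [y z|h args /rangeP[u ->]|R args /rangeP[u ->]].
  - rewrite !inE => -[i _ <-] [j _ <-].
    by rewrite (Hf _ i erefl) (Hf _ j erefl) => /Exa.
  - have [k Ek] := clo h u; rewrite compA fx (proj1 (Fn _ _ _) Ek) Ek.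
    exact: Hf.
  - by rewrite compA fx.
have [h [h_emb _] h_f] := homF _ f (finite_image _ finite_finset) emb.
exists (h \o x); first exact: same_diagram_embedding.
rewrite -fx; apply: funext => i /=; rewrite h_f // inE generated_range //.
Qed.

Definition finite_language :=
  (exists (E : finType) (e : E -> func L), forall f, exists y, e y = f) /\
  (exists (E : finType) (e : E -> rsym L), forall R, exists y, e y = R).

(** A finite tuple over a finite language has finitely many atomic facts, so
its diagram can be written down as one formula. *)
Lemma definable_same_diagram (P : structure L) (I : finType) (d : I -> P) :
  finite_language ->
  definable (fun (N : structure L) (b : I -> N) => same_diagram d b).
Proof.
move=> [[E [e e_surj]] [E' [e' e'_surj]]].
have id_surj (T : finType) (x : T) : exists y, id y = x by exists x.
have ffun_surj n (u : 'I_n -> I) : exists f : {ffun 'I_n -> I}, f =1 u :> (_ -> _).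
  by exists (finfun u) => i; rewrite ffunE.
have ffun_surj' n (u : 'I_n -> I) : exists f : {ffun 'I_n -> I}, (f : _ -> _) = u.
  by have [f fu] := ffun_surj n u; exists f; apply: funext.
have dEq : definable (fun (N : structure L) (b : I -> N) => forall i j, d i = d j <-> b i = b j).
  apply: (definable_forall_index (id_surj I)) => i.
  apply: (definable_forall_index (id_surj I)) => j.
  apply: definable_equiv; first exact: definable_cst.
  by apply: definable_eq; apply: term_definable_var.
have dFun : definable (fun (N : structure L) (b : I -> N) =>
    forall (f : func L) (u : 'I_(farity f) -> I) k,
        ifunc (d \o u) = d k <-> ifunc (b \o u) = b k).
  apply: (definable_forall_index e_surj) => f.
  apply: (definable_forall_index (@ffun_surj' _)) => u.
  apply: (definable_forall_index (id_surj I)) => k.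
  apply: definable_equiv; first exact: definable_cst.
  apply: definable_eq; last exact: term_definable_var.
  by apply: (@term_definable_app L f) => i; apply: term_definable_var.
have dRel : definable (fun (N : structure L) (b : I -> N) =>
    forall (R : rsym L) (u : 'I_(rarity R) -> I),
        irel (d \o u) <-> irel (b \o u)).
  apply: (definable_forall_index e'_surj) => R.
  apply: (definable_forall_index (@ffun_surj' _)) => u.
  apply: definable_equiv; first exact: definable_cst.
  by apply: (@definable_rel L R) => i; apply: term_definable_var.
apply: definable_iff (definable_and dEq (definable_and dFun dRel)) _ => N v.
by split=> [[? [? ?]]|[? ? ?]].
Qed.

(** In the terms of classical model theory, [N] satisfies the extension axiom
for the finite structures enumerated by [d \o g] and [d].  The structure [P]
is arbitrary: the diagram [d] may come from [N] itself, or from a finite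
structure that has only been shown to embed in [F]. *)
Lemma limit_model_extend (F N P : structure L) (I J : finType) (g : I -> J)
    (d : J -> P) (a : I -> N) :
  finite_language -> ultrahomogeneous F -> model_of N (Th F) ->
  (exists x : J -> F, same_diagram d x) -> closed_tuple (d \o g) ->
  same_diagram (d \o g) a ->
  exists2 a' : J -> N, same_diagram d a' & a' \o g = a.
Proof.
move=> finL homF NF [x dx] clo; move: a.
have def : elementary_property (fun N : structure L => forall a : I -> N,
    same_diagram (d \o g) a -> exists a' : J -> N,
      same_diagram d a' /\ (forall i, a' (g i) = a i)).
  apply: elementary_forall; apply: definable_imp (definable_same_diagram (d \o g) finL) _.
  apply: (@definable_exists_tuple L J I (fun N w =>
    same_diagram d (w \o inr) /\ (forall i, w (inr (g i)) = w (inl i)))).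
  apply: definable_and.
    exact: (definable_rename inr (definable_same_diagram d finL)).
  apply: (@definable_forall_index L I I id) => [i|i]; first by exists i.
  by apply: definable_eq; apply: term_definable_var.
move=> a da; have [|a' [da' Ea']] := proj1 (elementary_transfer NF def) _ a da.
  move=> b db; have dxg := same_diagram_comp g dx.
  have [|b' xb' Eb'] := @ultrahomogeneous_extend F homF I J g x b
    (closed_same_diagram dxg clo).
    exact: same_diagram_trans (same_diagram_sym dxg) db.
  exists b'; split; first exact: same_diagram_trans dx xb'.
  by move=> i; rewrite -Eb'.
by exists a' => //; apply: funext.
Qed.

Lemma diagram_realized (F N P : structure L) (J : finType) (d : J -> P) :
  finite_language -> model_of N (Th F) ->
  (exists x : J -> F, same_diagram d x) <-> (exists x : J -> N, same_diagram d x).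
Proof.
move=> finL NF.
exact: elementary_transfer NF (elementary_exists (definable_same_diagram d finL)).
Qed.

Section Substructure.
Variables (M : structure L) (S : set M).

Definition generated_closed : closed_under_functions (generated S).
Proof.
move=> f args args_gen B [cloB SB]; apply: (cloB f args) => i.
exact: (args_gen i B (conj cloB SB)).
Qed.

(** The class of a Fraisse limit is given as a class of structures, whereas
homogeneity speaks of subsets; this is the substructure generated by [S] as a
structure in its own right. *)
Definition generated_structure : structure L :=
  @Structure L {x : M | generated S x}
    (fun f args => exist _ (ifunc (fun i => sval (args i)))
                         (generated_closed (fun i => proj2_sig (args i))))
    (fun R args => irel (fun i => sval (args i))).

Definition generated_inclusion : generated_structure -> M := sval.

Lemma generated_inclusion_embedding : embedding generated_inclusion.
Proof.
split=> // -[x px] [y py] _ _ /= Exy.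
exact: eq_exist.
Qed.

Lemma generated_structure_age : finite_set S -> age M generated_structure.
Proof.
move=> finS; split; last by exists generated_inclusion; exact: generated_inclusion_embedding.
exists (generated_inclusion @^-1` S).
  apply: finite_preimage => // x y _ _.
  by case: generated_inclusion_embedding => inj _ _; apply: inj; exact: in_setT.
apply/seteqP; split=> // -[x px] _ B [cloB SB].
suff [q Bq] : [set y | exists q, B (exist _ y q)] x by rewrite (Prop_irrelevance px q).
apply: px; split.
  move=> f args args_B.
  pose q i := sval (cid (args_B i)).
  have Bq i : B (exist _ (args i) (q i)) := svalP (cid (args_B i)).
  exists (generated_closed q).
  exact: (cloB f (fun i => exist _ (args i) (q i))).
move=> y Sy; exists (@sub_gen_smallest _ _ _ _ Sy); exact: SB.
Qed.

End Substructure.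
End Homogeneity.

(** * The universal theory of meet trees with circular orders on cones *)

(** The theory [Tstar_forall] speaks of the circular order on the set of cones,
hence of sets of elements.  These are its consequences in the elements
themselves; being quantifier-free, they hold at given elements if and only if
they hold at the images under an embedding, and their universal closure is one
first-order sentence.
Moving only the first point within its cone suffices, since [C] can be
rotated, and it keeps the number of variables at five. *)
Definition tree_axioms_at (N : structure Lstar) (x y z u v : N) : Prop :=
  [/\ [/\ tle x x, tle x y -> tle y x -> x = y,
          tle x y -> tle y z -> tle x z
        & tle y x -> tle z x -> tle y z \/ tle z y],
      [/\ tle (tmeet x y) x, tle (tmeet x y) y
        & tle z x -> tle z y -> tle z (tmeet x y)],
      tC x y z u -> same_cone x y v -> tC x v z u,
      tC x y z u -> [/\ tlt x y, tlt x z & tlt x u]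
    & [/\ tC x y z u -> tC x z u y,
          tC x y z u -> ~ tC x u z y,
          tC x y z u -> tC x y u v -> tC x y z v
        & tlt x y -> tlt x z -> tlt x u -> ~ same_cone x y z ->
          ~ same_cone x z u -> ~ same_cone x y u ->
          tC x y z u \/ tC x u z y]].

Definition tree_axioms (N : structure Lstar) : Prop :=
  forall x y z u v : N, tree_axioms_at x y z u v.

Section TstarForall.
Variable N : structure Lstar.

Lemma meet_tree_same_cone_refl (x y : N) : meet_tree N -> tlt x y -> same_cone x y y.
Proof.
move=> [refl anti tr _ meetP] xy; have [yl _ yg] := meetP y y.
have E : tmeet y y = y by apply: anti => //; apply: yg.
by split=> //; rewrite E.
Qed.

Lemma meet_tree_same_cone_sym (x y z : N) : meet_tree N -> same_cone x y z -> same_cone x z y.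
Proof.
move=> [refl anti tr _ meetP] [xy xz xyz]; split=> //.
suff <- : tmeet y z = tmeet z y by [].
have [? ? ?] := meetP y z; have [? ? ?] := meetP z y.
by apply: anti; auto.
Qed.

Lemma Tstar_forall_tree_axioms : Tstar_forall N -> tree_axioms N.
Proof.
move=> [mt cong pos circ] x y z u v.
have [refl anti tr tree meetP] := mt.
have sc_refl := @meet_tree_same_cone_refl _ _ mt.
have sc_sym (a b c : N) : same_cone a b c -> same_cone a c b.
  exact: meet_tree_same_cone_sym mt.
pose cone c := [set b | same_cone x c b]%classic.
have D c : tlt x c -> open_cones x (cone c) by exists c.
have relP a b c : tlt x a -> tlt x b -> tlt x c ->
    cone_rel x (cone a) (cone b) (cone c) <-> tC x a b c.
  move=> xa xb xc; split; last first.
    by exists a, b, c; split=> //; exact: sc_refl.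
  move=> [a' [b' [c' [aa bb cc C]]]].
  by apply: cong C _ _ _; exact: sc_sym.
have [cyc asym trans total] := circ x.
have cone_neq a b : tlt x b -> ~ same_cone x a b -> cone a <> cone b.
  move=> xb nab E; apply: nab.
  have : cone b b by exact: sc_refl.
  by rewrite -E.
split=> //.
- by split; [exact: refl | exact: anti | exact: tr | exact: tree].
- by have [? ? ?] := meetP x y; split; auto.
- by move=> C yv; have [xy xz xu] := pos _ _ _ _ C; apply: cong C yv _ _; exact: sc_refl.
- exact: pos.
- split.
  + move=> C; have [xy xz xu] := pos _ _ _ _ C.
    by apply/relP => //; apply: cyc; auto; apply/relP.
  + move=> C; have [xy xz xu] := pos _ _ _ _ C => C'.
    by apply: (asym (cone y) (cone z) (cone u)); auto; apply/relP.
  + move=> C C'; have [xy xz xu] := pos _ _ _ _ C; have [_ _ xv] := pos _ _ _ _ C'.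
    by apply/relP => //; apply: (trans _ _ (cone u)); auto; apply/relP.
  + move=> xy xz xu nyz nzu nyu.
    rewrite -!relP //; apply: total; auto.
Qed.

End TstarForall.

Section TreeEmbedding.
Variables (N F : structure Lstar) (h : N -> F).
Hypothesis h_emb : embedding h.

Lemma comp_tnth (T U : Type) (g : T -> U) n (t : n.-tuple T) :
  g \o tnth t = tnth (map_tuple g t).
Proof. by apply: funext => i /=; rewrite tnth_map. Qed.

Lemma embedding_eq (x y : N) : (h x = h y) = (x = y).
Proof.
case: h_emb => inj _ _; apply/propext; split=> [|-> //].
by apply: inj; exact: in_setT.
Qed.

Lemma embedding_tle (x y : N) : tle (h x) (h y) = tle x y.
Proof.
case: h_emb => _ _ hrel; apply/propext; rewrite /tle.
rewrite (hrel Le (tnth [tuple x; y])) // comp_tnth.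
by have -> : map_tuple h [tuple x; y] = [tuple h x; h y] by apply: val_inj.
Qed.

Lemma embedding_tC (x y z u : N) : tC (h x) (h y) (h z) (h u) = tC x y z u.
Proof.
case: h_emb => _ _ hrel; apply/propext; rewrite /tC.
rewrite (hrel Cstar (tnth [tuple x; y; z; u])) // comp_tnth.
by have -> : map_tuple h [tuple x; y; z; u] = [tuple h x; h y; h z; h u]
  by apply: val_inj.
Qed.

Lemma embedding_tmeet (x y : N) : tmeet (h x) (h y) = h (tmeet x y).
Proof.
case: h_emb => _ hfun _; rewrite /tmeet.
rewrite (hfun Meet (tnth [tuple x; y])) // comp_tnth.
by have -> : map_tuple h [tuple x; y] = [tuple h x; h y] by apply: val_inj.
Qed.

Lemma tree_axioms_at_embedding (x y z u v : N) :
  tree_axioms_at (h x) (h y) (h z) (h u) (h v) <-> tree_axioms_at x y z u v.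
Proof.
by rewrite /tree_axioms_at /same_cone /tlt !embedding_tmeet !embedding_tle
  !embedding_tC !embedding_eq.
Qed.

End TreeEmbedding.

(** Five elements of [F] generate a finite structure of the age, where the axioms
hold, and quantifier-free conditions can be tested there. *)
Lemma limit_tree_axioms (F : structure Lstar) :
  fraisse_limit finite_Tstar_forall F -> tree_axioms F.
Proof.
move=> [_ ageF _] x y z u v.
pose S := [set x; y; z; u; v]%classic.
have /ageF[_ /Tstar_forall_tree_axioms ax] : age F (generated_structure S).
  by apply: generated_structure_age; rewrite !finite_setU; do !split; exact: finite_set1.
have emb := generated_inclusion_embedding S.
have lift w : S w -> exists w', @generated_inclusion _ _ S w' = w.
  by move=> Sw; exists (exist _ w (@sub_gen_smallest _ _ _ _ Sw)).
have [|x' <-] := lift x; first by do 4!left.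
have [|y' <-] := lift y; first by do 3!left; right.
have [|z' <-] := lift z; first by do 2!left; right.
have [|u' <-] := lift u; first by left; right.
have [|v' <-] := lift v; first by right.
by apply/(tree_axioms_at_embedding emb).
Qed.

Lemma finite_language_Lstar : finite_language Lstar.
Proof.
split; first by exists unit, (fun=> Meet) => -[]; exists tt.
by exists bool, (fun b : bool => if b then Le else Cstar) => -[]; [exists true | exists false].
Qed.

Lemma term_definable_tmeet V (s t : forall N : structure Lstar, (V -> N) -> N) :
  term_definable s -> term_definable t ->
  term_definable (fun N v => tmeet (s N v) (t N v)).
Proof.
move=> [s' Hs] [t' Ht]; exists (@App Lstar V Meet (tnth [tuple s'; t'])) => N v /=.
rewrite -[fun i => _]/(eval v \o tnth [tuple s'; t']) comp_tnth /tmeet.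
by congr (ifunc (tnth _)); apply: val_inj; rewrite /= Hs Ht.
Qed.

Lemma definable_tle V (s t : forall N : structure Lstar, (V -> N) -> N) :
  term_definable s -> term_definable t ->
  definable (fun N v => tle (s N v) (t N v)).
Proof.
move=> [s' Hs] [t' Ht]; exists (@Rel Lstar V Le (tnth [tuple s'; t'])) => N v /=.
rewrite -[fun i => _]/(eval v \o tnth [tuple s'; t']) comp_tnth /tle.
suff -> : map_tuple (eval v) [tuple s'; t'] = [tuple s N v; t N v] by [].
by apply: val_inj; rewrite /= Hs Ht.
Qed.

Lemma definable_tC V (s t t' t'' : forall N : structure Lstar, (V -> N) -> N) :
  term_definable s -> term_definable t -> term_definable t' -> term_definable t'' ->
  definable (fun N v => tC (s N v) (t N v) (t' N v) (t'' N v)).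
Proof.
move=> [a Ha] [b Hb] [c Hc] [d Hd].
exists (@Rel Lstar V Cstar (tnth [tuple a; b; c; d])) => N v /=.
rewrite -[fun i => _]/(eval v \o tnth [tuple a; b; c; d]) comp_tnth /tC.
suff -> : map_tuple (eval v) [tuple a; b; c; d] =
  [tuple s N v; t N v; t' N v; t'' N v] by [].
by apply: val_inj; rewrite /= Ha Hb Hc Hd.
Qed.

Lemma elementary_tree_axioms : elementary_property tree_axioms.
Proof.
pose at5 (N : structure Lstar) (w : 'I_5 -> N) :=
  tree_axioms_at (w (inord 0)) (w (inord 1)) (w (inord 2)) (w (inord 3)) (w (inord 4)).
have def : definable at5.
  rewrite /at5 /tree_axioms_at /same_cone /tlt.
  have and3 V (P Q R : forall N : structure Lstar, (V -> N) -> Prop) :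
    definable P -> definable Q -> definable R ->
    definable (fun N v => [/\ P N v, Q N v & R N v]).
    move=> dP dQ dR; apply: definable_iff (definable_and dP (definable_and dQ dR)) _.
    by move=> N v; split=> [[? []]|[]].
  have and4 V (P Q R S : forall N : structure Lstar, (V -> N) -> Prop) :
    definable P -> definable Q -> definable R -> definable S ->
    definable (fun N v => [/\ P N v, Q N v, R N v & S N v]).
    move=> dP dQ dR dS.
    apply: definable_iff (definable_and dP (and3 _ _ _ _ dQ dR dS)) _.
    by move=> N v; split=> [[? []]|[]].
  have and5 V (P Q R S T : forall N : structure Lstar, (V -> N) -> Prop) :
    definable P -> definable Q -> definable R -> definable S -> definable T ->
    definable (fun N v => [/\ P N v, Q N v, R N v, S N v & T N v]).
    move=> dP dQ dR dS dT.
    apply: definable_iff (definable_and dP (and4 _ _ _ _ _ dQ dR dS dT)) _.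
    by move=> N v; split=> [[? []]|[]].
  repeat first
    [ apply: term_definable_var | apply: term_definable_tmeet
    | apply: definable_tle | apply: definable_tC | apply: definable_eq
    | apply: and5 | apply: and4 | apply: and3 | apply: definable_and
    | apply: definable_not | apply: definable_or | apply: definable_imp ].
apply: definable_iff (elementary_forall def) _ => N _; split=> [H x y z u v|H w].
  have := H (tnth [tuple x; y; z; u; v]).
  by rewrite /at5 !(tnth_nth x) !inordK.
exact: H.
Qed.

Section LstarDiagram.

Lemma tnth2E (T : Type) (u : 'I_2 -> T) : u = tnth [tuple u ord0; u ord_max].
Proof.
apply: funext => -[[|[|//]] lt_i]; first by congr u; apply: val_inj.
by rewrite (tnth_nth (u ord0)) /=; congr u; apply: val_inj.
Qed.

Lemma tnth4E (T : Type) (u : 'I_4 -> T) :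
  u = tnth [tuple u (inord 0); u (inord 1); u (inord 2); u (inord 3)].
Proof.
apply: funext => i; rewrite (tnth_nth (u i)).
by case: i => [[|[|[|[|//]]]] lt_i] /=; congr u; apply: val_inj; rewrite /= inordK.
Qed.

Lemma comp_tnth2 (T U : Type) (g : T -> U) x y :
  g \o tnth [tuple x; y] = tnth [tuple g x; g y].
Proof. by rewrite comp_tnth; congr tnth; apply: val_inj. Qed.

Lemma comp_tnth4 (T U : Type) (g : T -> U) x y z t :
  g \o tnth [tuple x; y; z; t] = tnth [tuple g x; g y; g z; g t].
Proof. by rewrite comp_tnth; congr tnth; apply: val_inj. Qed.

Variables (I : Type) (M N : structure Lstar) (a : I -> M) (b : I -> N).

Lemma same_diagramP : same_diagram a b <->
  [/\ forall i j, a i = a j <-> b i = b j,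
      forall i j k, tmeet (a i) (a j) = a k <-> tmeet (b i) (b j) = b k,
      forall i j, tle (a i) (a j) <-> tle (b i) (b j)
    & forall i j k l, tC (a i) (a j) (a k) (a l) <-> tC (b i) (b j) (b k) (b l)].
Proof.
split=> [[Eq Fn Rl]|[Eq Fn Le2 C4]].
  split=> // [i j k|i j|i j k l].
  - by have := Fn Meet (tnth [tuple i; j]) k; rewrite !comp_tnth2.
  - by have := Rl Le (tnth [tuple i; j]); rewrite !comp_tnth2.
  - by have := Rl Cstar (tnth [tuple i; j; k; l]); rewrite !comp_tnth4.
split=> // [[] u k|[] u].
- by rewrite (tnth2E u) !comp_tnth2; apply: Fn.
- by rewrite (tnth2E u) !comp_tnth2; apply: Le2.
- by rewrite (tnth4E u) !comp_tnth4; apply: C4.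
Qed.

Lemma closed_tupleP :
  closed_tuple a <-> forall i j, exists k, tmeet (a i) (a j) = a k.
Proof.
split=> [clo i j|clo [] u].
  by have := clo Meet (tnth [tuple i; j]); rewrite comp_tnth2.
by rewrite (tnth2E u) comp_tnth2; apply: clo.
Qed.

End LstarDiagram.

Section TreeTheory.
Variable N : structure Lstar.
Hypothesis ax : tree_axioms N.
Implicit Types x y z u v : N.

Lemma tle_refl x : tle x x.
Proof. by case: (ax x x x x x) => [[]]. Qed.

Lemma tle_anti x y : tle x y -> tle y x -> x = y.
Proof. by case: (ax x y x x x) => [[]]. Qed.

Lemma tle_trans y x z : tle x y -> tle y z -> tle x z.
Proof. by case: (ax x y z x x) => [[]]. Qed.

Lemma tle_tree x y z : tle y x -> tle z x -> tle y z \/ tle z y.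
Proof. by case: (ax x y z x x) => [[]]. Qed.

Lemma tmeet_lel x y : tle (tmeet x y) x.
Proof. by case: (ax x y x x x) => _ []. Qed.

Lemma tmeet_ler x y : tle (tmeet x y) y.
Proof. by case: (ax x y x x x) => _ []. Qed.

Lemma tle_meet x y z : tle z x -> tle z y -> tle z (tmeet x y).
Proof. by case: (ax x y z x x) => _ []. Qed.

Lemma tC_congr x y z u v : tC x y z u -> same_cone x y v -> tC x v z u.
Proof. by case: (ax x y z u v). Qed.

Lemma tC_lt x y z u : tC x y z u -> [/\ tlt x y, tlt x z & tlt x u].
Proof. by case: (ax x y z u x). Qed.

Lemma tC_rot x y z u : tC x y z u -> tC x z u y.
Proof. by case: (ax x y z u x) => _ _ _ _ []. Qed.

Lemma tC_asym x y z u : tC x y z u -> ~ tC x u z y.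
Proof. by case: (ax x y z u x) => _ _ _ _ []. Qed.

Lemma tC_trans x y z u v : tC x y z u -> tC x y u v -> tC x y z v.
Proof. by case: (ax x y z u v) => _ _ _ _ []. Qed.

Lemma tC_total x y z u : tlt x y -> tlt x z -> tlt x u ->
  ~ same_cone x y z -> ~ same_cone x z u -> ~ same_cone x y u ->
  tC x y z u \/ tC x u z y.
Proof. by case: (ax x y z u x) => _ _ _ _ []. Qed.

Lemma tmeet_id x : tmeet x x = x.
Proof.
apply: tle_anti; [exact: tmeet_lel | apply: tle_meet]; exact: tle_refl.
Qed.

Lemma tmeetC x y : tmeet x y = tmeet y x.
Proof.
by apply: tle_anti; apply: tle_meet; (exact: tmeet_lel || exact: tmeet_ler).
Qed.

Lemma tmeet_idr x y : tle x y -> tmeet x y = x.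
Proof.
move=> xy; apply: tle_anti; first exact: tmeet_lel.
by apply: tle_meet => //; exact: tle_refl.
Qed.

Lemma tmeetA x y z : tmeet x (tmeet y z) = tmeet (tmeet x y) z.
Proof.
have l := tmeet_lel; have r := tmeet_ler.
apply: tle_anti.
  apply: tle_meet; first apply: tle_meet; first exact: l.
    exact: tle_trans (r _ _) (l _ _).
  exact: tle_trans (r _ _) (r _ _).
apply: tle_meet; last apply: tle_meet; last exact: r.
  exact: tle_trans (l _ _) (l _ _).
exact: tle_trans (l _ _) (r _ _).
Qed.

Lemma tlt_irr x : ~ tlt x x.
Proof. by case. Qed.

Lemma tlt_le_trans y x z : tlt x y -> tle y z -> tlt x z.
Proof.
move=> [xy nxy] yz; split; first exact: tle_trans yz.
by move=> E; apply: nxy; apply: tle_anti => //; rewrite E.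
Qed.

Lemma same_cone_refl x y : tlt x y -> same_cone x y y.
Proof. by move=> xy; split=> //; rewrite tmeet_id. Qed.

Lemma same_cone_sym x y z : same_cone x y z -> same_cone x z y.
Proof. by case=> *; split=> //; rewrite tmeetC. Qed.

Lemma tmeet_distinct_cones x y z :
  tlt x y -> tlt x z -> ~ same_cone x y z -> tmeet y z = x.
Proof.
move=> xy xz nyz; apply: contrapT => nE; apply: nyz; split=> //; split.
  by apply: tle_meet; [case: xy | case: xz].
by move=> E; apply: nE.
Qed.

Lemma tC_distinct_cones x y z u : tC x y z u -> ~ same_cone x y z.
Proof.
move=> C yz; have {}C := tC_rot (tC_congr C yz).
exact: (tC_asym C C).
Qed.

(** Adding [x] to a set closed under meets, one only has to add the meets of [x]
with that set: a meet of two of these is [x] met with an old element. *)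
Definition adjoin (I : Type) (a : I -> N) x (w : I + option I) : N :=
  match w with
  | inl i => a i
  | inr None => x
  | inr (Some i) => tmeet x (a i)
  end.

Lemma adjoin_closed (I : Type) (a : I -> N) x :
  closed_tuple a -> closed_tuple (adjoin a x).
Proof.
move=> /closed_tupleP clo; apply/closed_tupleP.
have dup y z : tmeet (tmeet x y) (tmeet x z) = tmeet x (tmeet y z).
  by rewrite -tmeetA (tmeetA y) (tmeetC y) -!tmeetA tmeetA tmeet_id.
have absorb y : tmeet x (tmeet x y) = tmeet x y by rewrite tmeetA tmeet_id.
move=> [i|[i|]] [j|[j|]] /=; try (have [k Ek] := clo i j).
- by exists (inl k).
- by exists (inr (Some k)); rewrite tmeetC -tmeetA (tmeetC (a j)) Ek.
- by exists (inr (Some i)); rewrite tmeetC.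
- by exists (inr (Some k)); rewrite -tmeetA Ek.
- by exists (inr (Some k)); rewrite dup Ek.
- by exists (inr (Some i)); rewrite tmeetC absorb.
- by exists (inr (Some j)).
- by exists (inr (Some j)); rewrite absorb.
- by exists (inr None); rewrite tmeet_id.
Qed.

(** Closing under meets yields nothing above the given elements, so an
element maximal among these is maximal in the closure. *)
Lemma finite_closure (r : N) (e : nat -> N) n :
  exists (I : finType) (a : I -> N),
    [/\ closed_tuple a, exists i, a i = r,
        forall k, k < n -> exists i, a i = e k
      & forall i, tle (a i) r \/ exists2 k, k < n & tle (a i) (e k)].
Proof.
elim: n => [|n [I [a [clo [ir Er] ae below]]]].
  exists (unit : finType), (fun=> r); split=> //.
    by apply/closed_tupleP => _ _; exists tt; rewrite tmeet_id.
  by left; exact: tle_refl.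
exists (I + option I : finType)%type, (adjoin a (e n)); split.
- exact: adjoin_closed.
- by exists (inl ir).
- move=> k; rewrite ltnS leq_eqVlt => /orP[/eqP->|/ae[i Ei]].
    by exists (inr None).
  by exists (inl i).
- move=> [i|[i|]] /=.
  + case: (below i) => [|[k kn le]]; [by left | right; exists k => //].
    exact: ltnW.
  + by right; exists n => //; exact: tmeet_lel.
  + by right; exists n => //; exact: tle_refl.
Qed.

Lemma exists_maximal (r : N) (e : nat -> N) n :
  exists m, [/\ m = r \/ exists2 k, k < n & m = e k, ~ tlt m r
    & forall k, k < n -> ~ tlt m (e k)].
Proof.
elim: n => [|n [m [m_in mr me]]].
  by exists r; split=> //; [left | exact: tlt_irr].
have [m_lt|m_nlt] := pselect (tlt m (e n)).
  have up x : ~ tlt m x -> ~ tlt (e n) x.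
    by move=> nx lt_x; apply: nx; apply: tlt_le_trans m_lt _; case: lt_x.
  exists (e n); split=> [||k]; [by right; exists n | exact: up |].
  rewrite ltnS leq_eqVlt => /orP[/eqP->|kn]; first exact: tlt_irr.
  by apply: up; exact: me.
exists m; split=> // [|k].
  by case: m_in => [|[k kn ->]]; [left | right; exists k => //; exact: ltnW].
by rewrite ltnS leq_eqVlt => /orP[/eqP->|/me].
Qed.

End TreeTheory.

(** * Points in distinct cones above a maximal element *)

Section Crown.
Variables (N : structure Lstar) (ax : tree_axioms N) (I J : Type).
Variables (e : I -> N) (i0 : I) (p : J -> N).

(** In this part [e i0] is a maximal entry of the tuple [e], and the points [p]
lie above it in pairwise distinct cones. *)
Definition crown := forall j, tlt (e i0) (p j).
Definition scattered := forall j j', j <> j' -> ~ same_cone (e i0) (p j) (p j').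
Hypothesis e_max : forall i, ~ tlt (e i0) (e i).
Hypotheses (p_above : crown) (p_scat : scattered).

Lemma crown_inj j j' : p j = p j' <-> j = j'.
Proof.
split=> [E|-> //]; apply: contrapT => /p_scat; apply; rewrite E.
exact: same_cone_refl.
Qed.

Lemma crown_nle j i : ~ tle (p j) (e i).
Proof. by move=> le; apply: (e_max (i := i)); exact: tlt_le_trans (p_above j) le. Qed.

Lemma crown_le j j' : tle (p j) (p j') <-> j = j'.
Proof.
split=> [le|->]; last exact: tle_refl.
apply: contrapT => /p_scat; apply; split=> //.
by rewrite tmeet_idr.
Qed.

(** An entry of [e] below [p j] is comparable with [e i0], and it cannot be
strictly above it. *)
Lemma tle_crown i j : tle (e i) (p j) <-> tle (e i) (e i0).
Proof.
have [m_le _] := p_above j; split=> [le|le]; last exact: tle_trans m_le.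
have [//|le'] := tle_tree ax le m_le.
have [E|nE] := pselect (e i0 = e i); first by rewrite -E; exact: tle_refl.
by case: (e_max (i := i)).
Qed.

Lemma tmeet_crown j j' : j <> j' -> tmeet (p j) (p j') = e i0.
Proof. by move=> /p_scat; exact: tmeet_distinct_cones. Qed.

Lemma tmeet_crown_base i j : tmeet (e i) (p j) = tmeet (e i) (e i0).
Proof.
have [m_le _] := p_above j.
apply: (tle_anti ax); apply: (tle_meet ax); try exact: tmeet_lel; last first.
  exact: tle_trans (tmeet_ler ax _ _) m_le.
have [//|le] := tle_tree ax (tmeet_ler ax (e i) (p j)) m_le.
have {}le : tle (e i0) (e i) by exact: tle_trans le (tmeet_lel ax _ _).
have [E|nE] := pselect (e i0 = e i); first by rewrite E; exact: tmeet_lel.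
by case: (e_max (i := i)).
Qed.

Let base (w : I + J) : I := if w is inl i then i else i0.

(** Below [e i0] all the points [p j] lie in the cone of [e i0], so [C] does not
distinguish them from [e i0]. *)
Lemma tC_crown i w1 w2 w3 : e i <> e i0 ->
  tC (e i) (vsum e p w1) (vsum e p w2) (vsum e p w3) <->
  tC (e i) (e (base w1)) (e (base w2)) (e (base w3)).
Proof.
move=> ne.
have rot (x y z u : N) : tC x y z u <-> tC x z u y.
  by split=> [/(tC_rot ax)//|/(tC_rot ax)/(tC_rot ax)].
have step w (y z : N) :
    tC (e i) (vsum e p w) y z <-> tC (e i) (e (base w)) y z.
  case: w => [//|j] /=; have [m_le m_neq] := p_above j.
  have key : tlt (e i) (e i0) -> same_cone (e i) (p j) (e i0).
    move=> lt; split=> //; first exact: tlt_le_trans m_le.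
    by rewrite tmeetC // tmeet_idr.
  split=> C; have [lt _ _] := tC_lt ax C.
    apply: (tC_congr ax C); apply: key; split=> //.
    by apply/(tle_crown i j); case: lt.
  by apply: (tC_congr ax C); apply: same_cone_sym => //; exact: key.
by rewrite step rot step rot step rot.
Qed.

Lemma tC_crown_top i w1 w2 w3 : e i = e i0 ->
  tC (e i) (vsum e p w1) (vsum e p w2) (vsum e p w3) <->
  match w1, w2, w3 with
  | inr j1, inr j2, inr j3 => tC (e i0) (p j1) (p j2) (p j3)
  | _, _, _ => False
  end.
Proof.
by move=> ->; case: w1 w2 w3 => [i1|j1] [i2|j2] [i3|j3] //=;
  split=> // /(tC_lt ax)[]; firstorder.
Qed.

Lemma tC_crown_point j y z u w : vsum e p w = y -> ~ tC (p j) y z u.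
Proof.
move=> <- /(tC_lt ax)[[le ne] _ _]; case: w le ne => [i /crown_nle//|j' /=].
by move=> /crown_le ->.
Qed.

End Crown.

Lemma crown_closed (N : structure Lstar) (I J : Type) (e : I -> N) i0 (p : J -> N) :
  tree_axioms N -> (forall i, ~ tlt (e i0) (e i)) ->
  crown e i0 p -> scattered e i0 p -> closed_tuple e -> closed_tuple (vsum e p).
Proof.
move=> ax mx ab sc /closed_tupleP clo; apply/closed_tupleP.
move=> [i|j] [i'|j'] /=.
- by have [k ->] := clo i i'; exists (inl k).
- by rewrite (tmeet_crown_base ax mx ab); have [k ->] := clo i i0; exists (inl k).
- rewrite tmeetC // (tmeet_crown_base ax mx ab).
  by have [k ->] := clo i' i0; exists (inl k).
- have [->|ne] := pselect (j = j'); first by exists (inr j'); rewrite tmeet_id.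
  by exists (inl i0); rewrite (tmeet_crown ax ab sc).
Qed.

(** Every atomic fact about [e] and [p] has been reduced to one about [e] alone,
or to the circular order of the points [p] above [e i0]. *)
Lemma crown_diagram (N N' : structure Lstar) (I J : Type) (e : I -> N)
    (e' : I -> N') i0 (p : J -> N) (p' : J -> N') :
  tree_axioms N -> tree_axioms N' -> same_diagram e e' -> closed_tuple e ->
  (forall i, ~ tlt (e i0) (e i)) ->
  crown e i0 p -> scattered e i0 p ->
  crown e' i0 p' -> scattered e' i0 p' ->
  (forall j1 j2 j3, tC (e i0) (p j1) (p j2) (p j3) <->
                    tC (e' i0) (p' j1) (p' j2) (p' j3)) ->
  same_diagram (vsum e p) (vsum e' p').
Proof.
move=> ax ax' ee clo mx ab sc ab' sc' pp'.
have [Eq Mt Le2 C4] := proj1 (same_diagramP _ _) ee.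
have mx' i : ~ tlt (e' i0) (e' i).
  by move=> [/Le2 le ne]; apply: (mx i); split=> // /Eq.
have {}clo := proj1 (closed_tupleP _) clo.
have ne (i : I) (j : J) : e i <> p j.
  by move=> E; apply: (crown_nle ax mx ab (j := j) (i := i)); rewrite E; exact: tle_refl.
have ne' (i : I) (j : J) : e' i <> p' j.
  by move=> E; apply: (crown_nle ax' mx' ab' (j := j) (i := i)); rewrite E; exact: tle_refl.
have MtE i i' w : tmeet (e i) (e i') = vsum e p w <-> tmeet (e' i) (e' i') = vsum e' p' w.
  case: w => [k|j] /=; first exact: Mt.
  have [k Ek] := clo i i'; have Ek' := proj1 (Mt _ _ _) Ek.
  by rewrite Ek Ek'; split=> [/ne|/ne'].
have EqE w w' : vsum e p w = vsum e p w' <-> vsum e' p' w = vsum e' p' w'.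
  case: w w' => [i|j] [i'|j'] /=; first exact: Eq.
  - by split=> [/ne|/ne'].
  - by split=> /esym => [/ne|/ne'].
  - by rewrite (crown_inj ax ab sc) (crown_inj ax' ab' sc').
apply/same_diagramP; split=> // [w w' k|w w'|w w1 w2 w3].
- case: w w' => [i|j] [i'|j'] /=.
  + exact: MtE.
  + by rewrite (tmeet_crown_base ax mx ab) (tmeet_crown_base ax' mx' ab').
  + rewrite (tmeetC ax) (tmeetC ax').
    by rewrite (tmeet_crown_base ax mx ab) (tmeet_crown_base ax' mx' ab').
  + have [->|njj] := pselect (j = j').
      by rewrite !tmeet_id //; exact: (EqE (inr j')).
    rewrite (tmeet_crown ax ab sc) // (tmeet_crown ax' ab' sc') //.
    exact: (EqE (inl i0)).
- case: w w' => [i|j] [i'|j'] /=; first exact: Le2.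
  + by rewrite (tle_crown ax mx ab) (tle_crown ax' mx' ab').
  + by split=> [/(crown_nle ax mx ab)|/(crown_nle ax' mx' ab')].
  + by rewrite (crown_le ax ab sc) (crown_le ax' ab' sc').
- case: w => [i|j] /=; last first.
    by split=> [/(tC_crown_point ax mx ab sc erefl)
               |/(tC_crown_point ax' mx' ab' sc' erefl)].
  have [E|nE] := pselect (e i = e i0).
    rewrite (tC_crown_top ax mx ab) // (tC_crown_top ax' mx' ab') //; last exact/Eq.
    by case: w1 w2 w3 => [?|?] [?|?] [?|?].
  rewrite (tC_crown ax mx ab) // (tC_crown ax' mx' ab') // => /Eq //.
Qed.

(** * Circular sequences of cones *)

Definition cyc (i j k : nat) : bool := [|| i < j < k, j < k < i | k < i < j].

(** A root [None] with [n] leaves, each of them an open cone, in the circular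
order of their indices. *)
Definition star (n : nat) : structure Lstar :=
  @Structure Lstar (option 'I_n)
    (fun f => match f return ('I_2 -> option 'I_n) -> option 'I_n with
       Meet => fun u => if u ord0 == u ord_max then u ord0 else None end)
    (fun R => match R return ('I_(@rarity Lstar R) -> option 'I_n) -> Prop with
       | Le => fun u => u ord0 = None \/ u ord0 = u ord_max
       | Cstar => fun u => u (inord 0) = None /\
           match u (inord 1), u (inord 2), u (inord 3) with
           | Some i, Some j, Some k => cyc i j k
           | _, _, _ => False
           end
       end).

Lemma tmeet_star n (x y : star n) :
  tmeet x y = if x == y :> option 'I_n then x else None.
Proof. by []. Qed.

Lemma tle_star n (x y : star n) : tle x y <-> x = None \/ x = y.
Proof. by []. Qed.

Lemma tC_star n (x y z u : star n) : tC x y z u <->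
  x = None /\ match y, z, u with
              | Some i, Some j, Some k => cyc i j k
              | _, _, _ => False
              end.
Proof. by rewrite /tC /= !(tnth_nth x) !inordK. Qed.

Lemma tlt_star n (x y : star n) : tlt x y <-> x = None /\ exists i, y = Some i.
Proof.
split; last by move=> [-> [i ->]]; split=> //; apply/tle_star; left.
move=> [/tle_star[->|//] ne]; split=> //; case: y ne => [i _|//]; by exists i.
Qed.

Lemma same_cone_star n (x y z : star n) :
  same_cone x y z <-> [/\ x = None, y = z & exists i, y = Some i].
Proof.
split=> [[/tlt_star[-> [i ->]] _ /tlt_star[_ [k]]]|[-> <- [i ->]]].
  by rewrite tmeet_star; case: eqP => // <-; split=> //; exists i.
by split; apply/tlt_star; split=> //; exists i => //; rewrite tmeet_star eqxx.
Qed.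

Lemma star_finite_Tstar_forall n : finite_Tstar_forall (star n).
Proof.
split; first exact: (@finite_finset (option 'I_n)).
split=> [|x y0 y1 y2 z0 z1 z2 C|x y0 y1 y2|x].
- split=> [x|x y|x y z|x y z|x y].
  + by apply/tle_star; right.
  + by move=> /tle_star[->|//] /tle_star[->|//].
  + by move=> /tle_star[->|->] // _; apply/tle_star; left.
  + by rewrite !tle_star => -[->|->] [->|->]; auto.
  + rewrite tmeet_star; case: eqP => [<-|ne]; split; rewrite ?tle_star; auto.
  move=> z; rewrite !tle_star => -[->|->] [E|E]; auto.
    by case: ne.
- by do 3![move/same_cone_star => [_ <- _]].
- move=> /tC_star[-> ]; case: y0 y1 y2 => [i|//] [j|//] [k|//] _.
  by split; apply/tlt_star; split=> //; eexists.
case: x => [i|].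
  by split=> [U V W|U V W|U V W X|U V W] [a /tlt_star[]].
pose pt (i : 'I_n) : set (star n) := [set Some i]%classic.
have DP U : @open_cones (star n) None U -> exists i, U = pt i.
  move=> [a /tlt_star[_ [i ->]] <-]; exists i; apply/seteqP; split=> b /=.
    by move=> /same_cone_star[].
  by move=> ->; apply/same_cone_star; split=> //; exists i.
have relP i j k : @cone_rel (star n) None (pt i) (pt j) (pt k) <-> cyc i j k.
  split=> [[u [v [w [-> -> -> /tC_star[]]]]] //|C].
  by exists (Some i), (Some j), (Some k); split=> //; apply/tC_star.
split.
- move=> U V W /DP[i ->] /DP[j ->] /DP[k ->]; rewrite !relP /cyc; lia.
- move=> U V W /DP[i ->] /DP[j ->] /DP[k ->]; rewrite !relP /cyc; lia.
- move=> U V W X /DP[i ->] /DP[j ->] /DP[k ->] /DP[l ->]; rewrite !relP /cyc; lia.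
- move=> U V W /DP[i ->] /DP[j ->] /DP[k ->].
  have neP a b : pt a <> pt b -> (a : nat) <> b by move=> ne /val_inj E; apply: ne; rewrite E.
  move=> /neP ij /neP jk /neP ik; rewrite !relP /cyc.
  have [C|C] := boolP [|| i < j < k, j < k < i | k < i < j]; [by left | right].
  lia.
Qed.

Section CircularSequence.
Variables F N : structure Lstar.
Hypotheses (F_limit : fraisse_limit finite_Tstar_forall F).
Hypothesis NF : model_of N (Th F).

Lemma model_tree_axioms : tree_axioms N.
Proof.
exact: (proj1 (elementary_transfer NF elementary_tree_axioms)) (limit_tree_axioms F_limit).
Qed.
Let ax := model_tree_axioms.

Lemma star_realized n :
  exists x : option 'I_n -> F, same_diagram (id : option 'I_n -> star n) x.
Proof.
have [_ ageF _] := F_limit.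
have [_ [h h_emb]] := proj2 (ageF _) (star_finite_Tstar_forall n).
exists h; exact: (same_diagram_embedding id h_emb).
Qed.

(** Any prescribed points in distinct cones above [m] that are arranged like some
leaves of the star can be completed to a copy of the whole star. *)
Lemma star_extend n (T : finType) (q : T -> 'I_n) (m : N) (p : T -> N) :
  injective q -> (forall t, tlt m (p t)) ->
  (forall t t', t <> t' -> ~ same_cone m (p t) (p t')) ->
  (forall t1 t2 t3, cyc (q t1) (q t2) (q t3) <-> tC m (p t1) (p t2) (p t3)) ->
  exists2 p' : 'I_n -> N, p' \o q = p &
    forall i j k : 'I_n, cyc i j k -> tC m (p' i) (p' j) (p' k).
Proof.
move=> q_inj ab sc qp.
have axS := Tstar_forall_tree_axioms (proj2 (star_finite_Tstar_forall n)).
have [_ _ homF] := F_limit.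
pose root : unit -> star n := fun=> None.
pose leaf (t : T) : star n := Some (q t).
pose g (w : unit + T) : option 'I_n := if w is inr t then Some (q t) else None.
have gE : id \o g = vsum root leaf by apply: funext => -[].
have clo : closed_tuple root.
  by apply/closed_tupleP => ? ?; exists tt.
have mx i : ~ tlt (root tt) (root i) by move=> [_ /(_ erefl)].
have abS : crown root tt leaf by move=> t; apply/tlt_star; split=> //; exists (q t).
have scS : scattered root tt leaf.
  by move=> t t' ne /same_cone_star[_ [/q_inj]].
have unit_diag : same_diagram root (fun _ : unit => m).
  apply/same_diagramP; split=> // *.
  - by rewrite tmeet_id.
  - by split=> _; [exact: tle_refl | left].
  - by split=> [/tC_star[_ []]|/(tC_lt ax)[[_ /(_ erefl) []]]].
have diag : same_diagram (id \o g : unit + T -> star n) (vsum (fun _ : unit => m) p).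
  rewrite gE; apply: (@crown_diagram _ _ _ _ _ _ tt) => // t1 t2 t3.
  by rewrite -qp; split=> [/tC_star[_ C] //|C]; apply/tC_star.
have [|a aS Ea] := @limit_model_extend _ F N (star n) _ _ g id _
  finite_language_Lstar homF NF (star_realized n) _ diag.
  by rewrite gE; exact: (crown_closed axS mx abS scS clo).
have [_ _ _ C4] := proj1 (same_diagramP _ _) aS.
have Em : a None = m by rewrite -[a None]/((a \o g) (inl tt)) Ea.
exists (a \o Some) => [|i j k C].
  by apply: funext => t; rewrite -[LHS]/((a \o g) (inr t)) Ea.
by rewrite -Em; apply/C4/tC_star.
Qed.

Lemma cone_triple (m : N) : exists a b c, tC m a b c.
Proof.
have [||||p _ Cp] := @star_extend 3 void (of_void _) m (of_void _); try by case.
exists (p (inord 0)), (p (inord 1)), (p (inord 2)); apply: Cp.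
by rewrite /cyc !inordK.
Qed.

(** The points [a] and [b] are the first and last leaf of a star with three
leaves, for two points carry no circular order; the middle leaf lies in the
arc between them. *)
Lemma arc_inhabited (m a b : N) :
  tlt m a -> tlt m b -> ~ same_cone m a b -> exists c, tC m a c b.
Proof.
move=> ma mb nab.
have [||||p Ep Cp] := @star_extend 3 bool (fun t => if t then inord 2 else inord 0)
  m (fun t => if t then b else a).
- by move=> [] [] // /(congr1 val); rewrite /= !inordK.
- by case.
- by move=> [] [] // _ /(same_cone_sym ax).
- move=> t1 t2 t3; split.
    by case: t1 t2 t3 => [] [] []; rewrite /cyc !inordK.
  move=> C; have C' := tC_rot ax C.
  have [lt1 lt2 lt3] := tC_lt ax C.
  have := tC_distinct_cones ax C; have := tC_distinct_cones ax C'.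
  have := tC_distinct_cones ax (tC_rot ax C').
  by case: t1 t2 t3 {C C'} lt1 lt2 lt3 => [] [] [] lt1 lt2 lt3 n1 n2 n3;
    exfalso; first [apply: n1; exact: (same_cone_refl ax)
      |apply: n2; exact: (same_cone_refl ax)|apply: n3; exact: (same_cone_refl ax)].
exists (p (inord 1)).
have := Cp (inord 0) (inord 1) (inord 2); rewrite /cyc !inordK // => /(_ isT).
by have := congr1 (@^~ true) Ep; have := congr1 (@^~ false) Ep => /= -> ->.
Qed.

(** Cutting the circle at [a] makes it a dense linear order without endpoints,
and [x n.+1] is chosen between [x n] and [a].  Three points of [x] are
compared through [a]. *)
Lemma circular_sequence (m : N) : exists p : nat -> N,
  forall i j k, i < j -> j < k -> tC m (p i) (p j) (p k).
Proof.
have [a [b [c abc]]] := cone_triple m.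
have [ma mb _] := tC_lt ax abc.
have nab := tC_distinct_cones ax abc.
have /choice[f Hf] : forall x, exists y,
    tlt m x -> ~ same_cone m x a -> tC m x y a.
  move=> x; have [[mx nx]|no] := pselect (tlt m x /\ ~ same_cone m x a).
    by have [y] := arc_inhabited mx ma nx; exists y.
  by exists x => *; case: no.
pose x n := iter n f b.
have x_ok n : tlt m (x n) /\ ~ same_cone m (x n) a.
  elim: n => [|n [mx nx]]; first by split=> // /(same_cone_sym ax).
  have C := Hf _ mx nx; have [_ my _] := tC_lt ax C.
  by split=> //; exact: tC_distinct_cones (tC_rot ax C).
have next n : tC m a (x n) (x n.+1).
  by have [mx nx] := x_ok n; do 2!apply: (tC_rot ax); exact: Hf.
have chain i j : i < j -> tC m a (x i) (x j).
  elim: j => // j IH; rewrite ltnS leq_eqVlt => /orP[/eqP->|/IH C]; first exact: next.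
  exact: (tC_trans ax C (next j)).
exists (fun n => if n is n'.+1 then x n' else a).
move=> [|i] [|j] [|k] // ij jk; first exact: chain.
have Cij := chain i j ij; have Cjk := chain j k jk.
do 2!apply: (tC_rot ax).
have C1 := tC_rot ax Cjk; have C2 := tC_rot ax (tC_rot ax Cij).
by apply: (tC_rot ax); do 2!apply: (tC_rot ax); exact: (tC_trans ax C1 C2).
Qed.

End CircularSequence.

Section CircularOrder.
Variables (N : structure Lstar) (ax : tree_axioms N) (m : N) (p : nat -> N).
Hypothesis p_circ : forall i j k, i < j -> j < k -> tC m (p i) (p j) (p k).

Lemma circular_above i : tlt m (p i).
Proof. by case: (tC_lt ax (p_circ (ltnSn i) (ltnSn i.+1))). Qed.

Lemma circular_distinct_cones i j : i <> j -> ~ same_cone m (p i) (p j).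
Proof.
have lt i' j' : i' < j' -> ~ same_cone m (p i') (p j').
  by move=> ij; exact: (tC_distinct_cones ax (p_circ ij (ltnSn j'))).
move=> ne; have [ij|ji] : i < j \/ j < i by lia.
  exact: lt.
by move=> /(same_cone_sym ax); exact: lt.
Qed.

Lemma tC_circular i j k : tC m (p i) (p j) (p k) <-> cyc i j k.
Proof.
have cycC i' j' k' : cyc i' j' k' -> tC m (p i') (p j') (p k').
  move=> /or3P[] /andP[? ?]; [exact: p_circ | |].
    by do 2!apply: (tC_rot ax); exact: p_circ.
  by apply: (tC_rot ax); exact: p_circ.
split; last exact: cycC.
move=> C; have C' := tC_rot ax C; have C'' := tC_rot ax C'.
have refl i' := same_cone_refl ax (circular_above i').
have ij : i <> j by move=> E; apply: (tC_distinct_cones ax C); rewrite E.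
have jk : j <> k by move=> E; apply: (tC_distinct_cones ax C'); rewrite E.
have ki : k <> i by move=> E; apply: (tC_distinct_cones ax C''); rewrite E.
apply: contrapT => nC; apply: (tC_asym ax C); apply: cycC.
by move: nC; rewrite /cyc; lia.
Qed.

(** If [x] above [m] is outside the open arc from [p 1] to [p 0], then it is in the closed
arc from [p 0] to [p 1], which lies inside the open arc from [p 3] to [p 2]. *)
Lemma closed_arcs_disjoint x : tlt m x ->
  tC m (p 1) x (p 0) \/ tC m (p 3) x (p 2).
Proof.
move=> mx.
have congr2 a b c : tC m a b c -> same_cone m b x -> tC m a x c.
  move=> C bx; do 2!apply: (tC_rot ax).
  by apply: (tC_congr ax) bx; exact: tC_rot.
have [x0|nx0] := pselect (same_cone m (p 0) x).
  by right; apply: congr2 x0; apply/tC_circular.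
have [x1|nx1] := pselect (same_cone m (p 1) x).
  by right; apply: congr2 x1; apply/tC_circular.
have [||||||C|C] := tC_total ax (x := m) (y := p 1) (z := x) (u := p 0).
- exact: circular_above.
- by [].
- exact: circular_above.
- by [].
- by move=> /(same_cone_sym ax).
- exact: circular_distinct_cones.
- by left.
right; have C012 : tC m (p 0) (p 1) (p 2) by apply/tC_circular.
have C230 : tC m (p 2) (p 3) (p 0) by apply/tC_circular.
have C20x := tC_rot ax (tC_rot ax (tC_trans ax C C012)).
exact: (tC_rot ax (tC_trans ax C230 C20x)).
Qed.

End CircularOrder.

(** * The language with a named root *)

Section Reduct.

(** The root is only one more entry in the tuples considered, so everything
except the final statement about types takes place in the meet tree. *)
Definition reduct (M : structure Lhat) : structure Lstar :=
  @Structure Lstar M (fun f => @ifunc Lhat M (Some f)) (@irel Lhat M).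

Fixpoint lift_term (V : Type) (t : term Lstar V) : term Lhat V :=
  match t with
  | Var x => Var Lhat x
  | App f args => @App Lhat V (Some f) (fun i => lift_term (args i))
  end.

Fixpoint lift_formula (V : Type) (phi : formula Lstar V) : formula Lhat V :=
  match phi with
  | Eq s t => Eq (lift_term s) (lift_term t)
  | Rel R args => @Rel Lhat V R (fun i => lift_term (args i))
  | Bot => Bot Lhat V
  | Imp phi psi => Imp (lift_formula phi) (lift_formula psi)
  | All phi => All (lift_formula phi)
  end.

Lemma eval_lift (M : structure Lhat) V (t : term Lstar V) (v : V -> M) :
  eval v (lift_term t) = eval (M := reduct M) v t.
Proof.
elim: t => //= f args IH; congr (@ifunc Lhat M (Some f)).
exact: funext.
Qed.

Lemma sat_lift (M : structure Lhat) V (phi : formula Lstar V) (v : V -> M) :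
  sat (lift_formula phi) v <-> sat (M := reduct M) phi v.
Proof.
elim: phi v => {V} [V s t|V R args|V|V phi IHphi psi IHpsi|V phi IH] v /=.
- by rewrite !eval_lift.
- suff -> : (fun i => eval v (lift_term (args i))) =
            (fun i => eval (M := reduct M) v (args i)) by [].
  by apply: funext => i; rewrite eval_lift.
- by [].
- by rewrite IHphi IHpsi.
- by split=> H x; apply/IH.
Qed.

Lemma reduct_name_const (M : structure Lstar) (r : M) V (phi : formula Lstar V)
    (v : V -> M) : sat (M := reduct (name_const r)) phi v <-> sat phi v.
Proof. by case: M r v. Qed.

Lemma reduct_model (F M : structure Lstar) (r : M) (MM : structure Lhat) :
  model_of M (Th F) -> model_of MM (Th (name_const r)) ->
  model_of (reduct MM) (Th F).
Proof.
move=> MF MMr phi phi_F; apply/sat_lift/MMr.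
by apply/sat_lift/reduct_name_const; exact: MF.
Qed.

Lemma definable_lift V (P : forall N : structure Lstar, (V -> N) -> Prop) :
  definable P -> definable (fun (N : structure Lhat) (v : V -> N) => P (reduct N) v).
Proof. by move=> [phi Hphi]; exists (lift_formula phi) => N v; rewrite sat_lift Hphi. Qed.

Variable MM : structure Lhat.

Definition root : MM := @ifunc Lhat MM None (@absurd_index _).

Lemma root_const (u : 'I_0 -> MM) : @ifunc Lhat MM None u = root.
Proof. by congr ifunc; apply: funext => -[]. Qed.

Lemma closed_tuple_reduct (I : Type) (a : I -> MM) :
  closed_tuple a <->
  closed_tuple (M := reduct MM) a /\ exists i, a i = root.
Proof.
split=> [clo|[clo [i Ei]] [f|] u].
- split=> [f u|]; first exact: (clo (Some f) u).
  have [i Ei] := clo None (@absurd_index _).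
  by exists i; rewrite -Ei root_const.
- exact: (clo f u).
- by exists i; rewrite Ei root_const.
Qed.

Lemma same_diagram_reduct (I : Type) (a b : I -> MM) :
  same_diagram a b <->
  same_diagram (M := reduct MM) (N := reduct MM) a b /\
  forall i, a i = root <-> b i = root.
Proof.
split=> [[Eq Fn Rl]|[[Eq Fn Rl] Rt]].
  split=> [|i].
    by split=> // f u k; exact: (Fn (Some f) u k).
  have := Fn None (@absurd_index _) i.
  by rewrite !root_const => H; split=> /esym/H/esym.
split=> // -[f|] u k; first exact: (Fn f u k).
by rewrite !root_const; split=> /esym/Rt/esym.
Qed.

End Reduct.

(** The root already occurs in a closed tuple, hence adjoining a point
creates no new fact about it. *)
Lemma diagram_extension_reduct (F : structure Lstar) (MM : structure Lhat) :
  fraisse_limit finite_Tstar_forall F -> model_of (reduct MM) (Th F) ->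
  diagram_extension MM.
Proof.
move=> F_limit MF I a b x /closed_tuple_reduct[clo [i0 Ei0]].
move=> /same_diagram_reduct[ab Rt].
have ax := model_tree_axioms F_limit MF; have [_ _ homF] := F_limit.
have [|b' ab' Eb'] := @limit_model_extend _ F (reduct MM) (reduct MM)
  I (I + option I)%type inl (adjoin (N := reduct MM) a x) b
  finite_language_Lstar homF MF _ clo ab.
  apply/(diagram_realized _ finite_language_Lstar MF).
  by exists (adjoin (N := reduct MM) a x); split.
exists (I + option I : finType)%type, inl, (adjoin (N := reduct MM) a x), b'.
split=> //.
- apply/closed_tuple_reduct; split; first exact: adjoin_closed.
  by exists (inl i0).
- apply/same_diagram_reduct; split=> // w.
  have [Eq _ _] := ab'; have b'0 : b' (inl i0) = root MM.
    by rewrite -[LHS]/((b' \o inl) i0) Eb'; apply/Rt.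
  by rewrite -{1}Ei0 -{1}b'0; exact: (Eq w (inl i0)).
- by exists (inr None).
Qed.

Lemma finite_set_enum (T : Type) (A : set T) (x0 : T) : finite_set A ->
  exists (e : nat -> T) n, forall c, A c <-> exists2 k, k < n & c = e k.
Proof.
move=> finA; have [s As] := proj1 (@finite_seqP {classic T} A) finA.
exists (nth (x0 : {classic T}) s), (size s) => c; rewrite As /=; split.
  by move=> /(nthP (x0 : {classic T}))[k ks <-]; exists k.
by move=> [k ks ->]; exact: mem_nth.
Qed.

(** * Forking over a finite set *)

(** Among the points above [m], the closed arc from [a] to [b] is the complement
of the open arc from [b] to [a].  In this form the two arcs given by [a] and [b] cover the cones above
[m] by asymmetry of [C] alone. *)
Definition closed_arc (N : structure Lstar) (m a b x : N) : Prop :=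
  tlt m x /\ ~ tC m b x a.

Lemma definable_tlt V (s t : forall N : structure Lhat, (V -> N) -> N) :
  term_definable s -> term_definable t ->
  definable (fun N v => @tlt (reduct N) (s N v) (t N v)).
Proof.
move=> ds dt.
have def : definable (fun (N : structure Lstar) (v : bool -> N) => tlt (v false) (v true)).
  apply: definable_and; last apply: definable_not.
    by apply: definable_tle; apply: term_definable_var.
  by apply: definable_eq; apply: term_definable_var.
apply: (@definable_subst Lhat bool V (fun x => if x then t else s) _ _ (definable_lift def)).
by case.
Qed.

Lemma definable_closed_arc V (m a b x : V) :
  definable (fun (N : structure Lhat) (v : V -> N) =>
    closed_arc (N := reduct N) (v m) (v a) (v b) (v x)).
Proof.
apply: (@definable_lift V (fun N v => closed_arc (v m) (v a) (v b) (v x))).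
have var := @term_definable_var Lstar V.
apply: definable_and; last apply: definable_not; last exact: definable_tC.
apply: definable_and; first exact: definable_tle.
by apply: definable_not; apply: definable_eq.
Qed.

Section Forking.
Local Open Scope classical_set_scope.
Variables (F : structure Lstar) (MM : structure Lhat).
Hypothesis F_limit : fraisse_limit finite_Tstar_forall F.
Hypothesis MF : model_of (reduct MM) (Th F).
Let ax : tree_axioms (reduct MM) := model_tree_axioms F_limit MF.

Variables (A : set MM) (I : finType) (e : I -> reduct MM) (i0 : I).
Hypothesis e_closed : closed_tuple e.
Hypothesis e_root : exists i, e i = root MM.
Hypothesis e_A : forall c, A c -> exists i, e i = c.
Hypothesis e_max : forall i, ~ tlt (e i0) (e i).
Variable p : nat -> reduct MM.
Hypothesis p_circ : forall i j k, i < j -> j < k -> tC (e i0) (p i) (p j) (p k).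

(** Only the circular order of the indices matters, not the linear one; in
particular any two pairs of distinct indices give the same type. *)
Lemma tp_circular (J : finType) (s t : J -> nat) (X : Type) (rho : X -> I + J) :
  injective s -> injective t ->
  (forall j1 j2 j3, cyc (s j1) (s j2) (s j3) <-> cyc (t j1) (t j2) (t j3)) ->
  @tp Lhat MM X A (vsum e (p \o s) \o rho) = @tp Lhat MM X A (vsum e (p \o t) \o rho).
Proof.
move=> s_inj t_inj st.
have crownP (u : J -> nat) : crown e i0 (p \o u).
  by move=> j; exact: circular_above.
have scatP (u : J -> nat) : injective u -> scattered e i0 (p \o u).
  move=> u_inj j j' ne; apply: (circular_distinct_cones ax p_circ).
  by move=> /u_inj.
have diag : same_diagram (vsum e (p \o s)) (vsum e (p \o t)).
  apply: (@crown_diagram _ _ _ _ _ _ i0) => //; try exact: scatP.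
  by move=> j1 j2 j3; rewrite !(tC_circular ax p_circ).
have clo : closed_tuple (vsum e (p \o s)).
  exact: (crown_closed ax e_max (crownP s) (scatP s s_inj) e_closed).
have /choice[c Hc] : forall x : A, exists i, e i = val x.
  by move=> x; apply: e_A; exact: set_valP.
pose sigma (z : X + A) : I + J := match z with inl x => rho x | inr x => inl (c x) end.
have E (u : J -> nat) :
    vsum (vsum e (p \o u) \o rho) (fun x : A => val x) = vsum e (p \o u) \o sigma.
  by apply: funext => -[//|x] /=.
apply/seteqP; suff iff phi : tp A (vsum e (p \o s) \o rho : X -> MM) phi <->
    tp A (vsum e (p \o t) \o rho : X -> MM) phi by split=> phi /iff.
rewrite /tp /= !E.
apply: (back_and_forth (diagram_extension_reduct F_limit MF)).
  by apply/closed_tuple_reduct; split=> //; have [i Ei] := e_root; exists (inl i).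
apply/same_diagram_reduct; split=> // w.
have [Eq _ _] := diag; have [i Ei] := e_root.
rewrite -{1}Ei -{1}Ei; exact: (Eq w (inl i)).
Qed.

Definition arc_params (u v : nat) (z : 'I_3) : MM :=
  if val z == 0 then e i0 else p (if val z == 1 then u else v).

(** The arcs from [p i.*2] to [p i.*2.+1] are pairwise disjoint, and the given
arc has their common type since two points carry no circular order. *)
Lemma closed_arc_divides (psi : formula Lhat ('I_1 + 'I_3)) u v : u <> v ->
  (forall w, sat (M := MM) psi w <->
    closed_arc (N := reduct MM) (w (inr (inord 0))) (w (inr (inord 1)))
      (w (inr (inord 2))) (w (inl ord0))) ->
  divides A (PFormula psi (arc_params u v)).
Proof.
move=> uv Hpsi; pose b i := arc_params i.*2 i.*2.+1.
exists b; split.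
- move=> k s t s_mono t_mono.
  (* The endpoints of the arc [s i] sit at the indices [(s i).*2 + b]. *)
  pose idx (s : 'I_k -> nat) (j : 'I_k * bool) := (s j.1).*2 + j.2.
  pose rho (z : 'I_k * 'I_3) : I + 'I_k * bool :=
    if val z.2 == 0 then inl i0 else inr (z.1, val z.2 != 1).
  have bE (s' : 'I_k -> nat) :
      (fun z : 'I_k * 'I_3 => b (s' z.1) z.2) = vsum e (p \o idx s') \o rho.
    apply: funext => -[i z]; rewrite /b /arc_params /rho /=.
    case: ifP => //= _; rewrite /idx /=; congr p.
    by case: ifP => //= _; rewrite ?addn0 ?addn1.
  have mono (s' : 'I_k -> nat) : {homo s' : i j / i < j} ->
      forall i j, (s' i < s' j) = (i < j).
    move=> s'_mono i j; apply/idP/idP => [lt|]; last exact: s'_mono.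
    rewrite ltnNge leq_eqVlt; apply/negP => /orP[/eqP/val_inj E|/s'_mono].
      by move: lt; rewrite E ltnn.
    by move: lt; lia.
  have idxE (s' : 'I_k -> nat) : {homo s' : i j / i < j} ->
      forall j1 j2, (idx s' j1 < idx s' j2) = (j1.1.*2 + j1.2 < j2.1.*2 + j2.2).
    move=> s'_mono [i1 b1] [i2 b2]; rewrite /idx /=.
    have := mono _ s'_mono i1 i2; have := mono _ s'_mono i2 i1.
    move: b1 b2 => [] [] /=; lia.
  have idx_inj (s' : 'I_k -> nat) : {homo s' : i j / i < j} -> injective (idx s').
    move=> s'_mono [i1 b1] [i2 b2] E.
    have := idxE _ s'_mono (i1, b1) (i2, b2); have := idxE _ s'_mono (i2, b2) (i1, b1).
    rewrite E ltnn /= => h1 h2.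
    have Ei : i1 = i2 by apply: val_inj; move: b1 b2 h1 h2 {E} => [] [] /=; lia.
    by rewrite Ei in h1 h2 *; move: b1 b2 h1 h2 {E} => [] [] //=; lia.
  rewrite !bE; apply: tp_circular; try exact: idx_inj.
  by move=> j1 j2 j3; rewrite /cyc !idxE.
- move=> i /=.
  pose idx (u' v' : nat) (j : bool) := if j then u' else v'.
  pose rho (z : 'I_3) : I + bool := if val z == 0 then inl i0 else inr (val z == 1).
  have prmE u' v' : arc_params u' v' = vsum e (p \o idx u' v') \o rho.
    by apply: funext => z; rewrite /arc_params /rho /=; case: ifP.
  rewrite /b !prmE; apply: tp_circular.
  + by move=> [] [] //=; rewrite /idx; lia.
  + by move=> [] [] //=; rewrite /idx; lia.
  + by move=> [] [] []; rewrite /cyc /idx; lia.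
- move=> [a Ha]; have /Hpsi := Ha 0; have /Hpsi := Ha 1.
  rewrite /closed_arc /b /arc_params /= !inordK //=.
  move=> [mx n32] [_ n10].
  by case: (closed_arcs_disjoint ax p_circ mx).
Qed.

Lemma forks_above (phi : formula Lhat ('I_1 + 'I_1)) (m : 'I_1 -> MM) :
  m ord0 = e i0 ->
  (forall w, sat (M := MM) phi w <-> @tlt (reduct MM) (w (inr ord0)) (w (inl ord0))) ->
  forks A (PFormula phi m).
Proof.
move=> Em Hphi.
have [psi Hpsi] := definable_closed_arc (inr (inord 0)) (inr (inord 1))
  (inr (inord 2)) (inl ord0 : 'I_1 + 'I_3).
exists 2, (fun j => PFormula psi (if j == ord0 then arc_params 0 1 else arc_params 1 0)).
split=> [j|a].
  by case: ifP => _; apply: closed_arc_divides.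
rewrite /holds /= => /Hphi /=; rewrite Em => mx.
have arcP u v : ~ tC (e i0) (p v) (a ord0) (p u) ->
    sat psi (vsum a (arc_params u v)).
  by move=> nC; apply/Hpsi; rewrite /closed_arc /arc_params /= !inordK.
have [C|nC] := pselect (tC (e i0) (p 1) (a ord0) (p 0)).
  by exists ord_max; apply: arcP; exact: tC_asym C.
by exists ord0; apply: arcP.
Qed.

End Forking.

Theorem proposition6p8
  (F : structure Lstar) (F_limit : fraisse_limit finite_Tstar_forall F)
  (M : structure Lstar) (M_model : model_of M (Th F)) (r : M)
  (kappa : Type) (MM : structure Lhat)
  (MM_model : model_of MM (Th (name_const r)))
  (MM_monster : monster kappa MM)
  (A : set MM) (A_finite : finite_set A) :
  ~ extension_base A.
Proof.
have MF := reduct_model M_model MM_model.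
have ax := model_tree_axioms F_limit MF.
have [c [n Ac]] := finite_set_enum (root MM) A_finite.
have [m [m_in m_root m_max]] := @exists_maximal (reduct MM) ax (root MM) c n.
have [I [e [e_closed e_root e_c below]]] := @finite_closure (reduct MM) ax (root MM) c n.
have e_A x : A x -> exists i, e i = x.
  by move=> /Ac[k kn ->]; exact: e_c.
have [i0 Em] : exists i, e i = m.
  by case: m_in => [->//|[k kn ->]]; exact: e_c.
have e_max i : ~ tlt (e i0) (e i).
  rewrite Em => lt; case: (below i) => [le|[k kn le]].
    by apply: m_root; exact: tlt_le_trans le.
  by apply: (m_max k kn); exact: tlt_le_trans le.
have [p p_circ] := circular_sequence F_limit MF (e i0).
have [phi Hphi] := definable_tlt (term_definable_var Lhat (inr ord0 : 'I_1 + 'I_1))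
  (term_definable_var Lhat (inl ord0)).
move=> /(_ 1 (fun=> p 0)); apply.
exists (PFormula phi (fun _ : 'I_1 => e i0)).
  by apply: (forks_above F_limit MF e_closed e_root e_A e_max p_circ) => // w; exact: Hphi.
move=> a a_real; apply/Hphi => /=.
have [t t_def tE] : exists2 t : forall N : structure Lhat, ('I_1 + (A `|` A)%classic -> N) -> N,
    term_definable t & forall b, t MM (vsum b (fun x : (A `|` A)%classic => val x)) = m.
  case: m_in => [->|m_in].
    exists (fun N _ => root N) => //.
    exists (@App Lhat _ None (@absurd_index _)).
    by move=> N v /=; rewrite root_const.
  have Am : (A `|` A)%classic m by left; apply/Ac.
  exists (fun N v => v (inr (SigSub (mem_set Am)))) => //.
  exact: term_definable_var.
(* The formula [m < x] over [A]: [m] is an element of [A] or the constant. *)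
have [theta Htheta] := definable_tlt t_def (term_definable_var Lhat (inl ord0)).
have /a_real/Htheta : tp (A `|` A)%classic (fun=> p 0) theta.
  by apply/Htheta; rewrite tE -Em; exact: circular_above p_circ 0.
by rewrite tE Em.
Qed.
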